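(* Let $R$ be a commutative ring with unit and let $E$ be a directed graph. If $E$ is countable, then there is a $*$-algebraic embedding (an injective $R$-algebra $*$-homomorphism) of the Leavitt path algebra $L_R(E)$ into $L_{2,R}$, and if $E^0$ is finite, then this embedding can be chosen to be unital. If $E$ is uncountable, then there is no embedding of $L_R(E)$ into $L_{2,R}$ as $R$-modules, i.e. there is no injective $R$-linear map $L_R(E)\to L_{2,R}$.
   Context: A directed graph $E=(E^0,E^1,r,s)$ consists of a set $E^0$ of vertices, a set $E^1$ of edges, and range and source maps $r,s\colon E^1\to E^0$. It is countable if both $E^0$ and $E^1$ are countable, and uncountable otherwise. Leavitt path algebra: for a commutative ring $R$ with unit, $L_R(E)$ is the universal (associative, not necessarily unital) $R$-algebra generated by $\{v,e,e^*: v\in E^0, e\in E^1\}$ subject to: (1) the $v\in E^0$ are pairwise orthogonal idempotents; (2) $s(e)e=er(e)=e$ for $e\in E^1$; (3) $r(e)e^*=e^*s(e)=e^*$ for $e\in E^1$; (4) $e^*f=\delta_{e,f}r(e)$ for $e,f\in E^1$; (5) $v=\sum_{s(f)=v}ff^*$ for each $v\in E^0$ with $0<|s^{-1}(v)|<\infty$. It carries the $R$-linear involution with $v\mapsto v$, $e\mapsto e^*$, $e^*\mapsto e$ and $(xy)^*=y^*x^*$. If $E^0$ is finite, $L_R(E)$ is unital with unit $\sum_{v\in E^0}v$. $L_{2,R}$ is the Leavitt path algebra of the graph with one vertex and two loops, i.e. the universal unital $R$-algebra generated by $a,a^*,b,b^*$ subject to $a^*a=b^*b=1=aa^*+bb^*$,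 with the $R$-linear involution (reversing products) interchanging $a$ with $a^*$ and $b$ with $b^*$.
   Formalization: The ring R is taken to be nonzero (over R = 0 every L_R(E) is 0, so the non-embedding claim fails), and in the unital clause E^0 is assumed nonempty (otherwise L_R(E) = 0 and its unit 0 cannot map to 1). *)

(* Defs.v *)
From HB Require Import structures.
From mathcomp Require Import all_boot all_algebra.
From mathcomp Require Import boolp classical_sets cardinality fsbigop.

Set Implicit Arguments.
Unset Strict Implicit.
Unset Printing Implicit Defensive.

Import GRing.Theory.
Local Open Scope ring_scope.
Local Open Scope quotient_scope.
Local Open Scope classical_set_scope.

(* Associative algebras that need not have a unit. *)
HB.mixin Record Lmodule_isNUAlgebra (R : comNzRingType) A of GRing.Lmodule R A := {
  numul : A -> A -> A;
  numulA : associative numul;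
  numulDl : left_distributive numul +%R;
  numulDr : right_distributive numul +%R;
  nuscalerAl : forall (k : R) (x y : A), k *: numul x y = numul (k *: x) y;
  nuscalerAr : forall (k : R) (x y : A), k *: numul x y = numul x (k *: y)
}.

#[short(type="nuAlgType")]
HB.structure Definition NUAlgebra (R : comNzRingType) :=
  {A of GRing.Lmodule R A & Lmodule_isNUAlgebra R A}.

Reserved Notation "x ** y" (at level 40, left associativity).
Notation "x ** y" := (numul x y) : ring_scope.

(* The involution is R-linear: scalars carry the trivial involution. *)
HB.mixin Record NUAlgebra_isStar (R : comNzRingType) A of NUAlgebra R A := {
  star : A -> A;
  starD : {morph star : x y / x + y};
  starZ : forall (k : R) (x : A), star (k *: x) = k *: star x;
  starM : forall x y : A, star (x ** y) = star y ** star x;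
  starK : involutive star
}.

#[short(type="starAlgType")]
HB.structure Definition StarAlgebra (R : comNzRingType) :=
  {A of NUAlgebra R A & NUAlgebra_isStar R A}.

Record star_hom (R : comNzRingType) (A B : starAlgType R) (f : A -> B) : Prop :=
  StarHom {
    star_hom_linear : linear f;
    star_hom_mul : {morph f : x y / x ** y};
    star_hom_star : {morph f : x / star x}
  }.

Record digraph := Digraph {
  vertex : choiceType;
  edge : choiceType;
  rng : edge -> vertex;
  src : edge -> vertex
}.

Definition countable_graph (E : digraph) : Prop :=
  countable [set: vertex E] /\ countable [set: edge E].

(* Formal nonunital algebra expressions in the generators v, e, e^*. *)
Inductive lterm (R : comNzRingType) (E : digraph) :=
| TVert of vertex E
| TEdge of edge E
| TGhost of edge E
| TZero
| TAdd of lterm R E & lterm R E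
| TOpp of lterm R E
| TScale of R & lterm R E
| TMul of lterm R E & lterm R E.

Arguments TVert {R E}.
Arguments TEdge {R E}.
Arguments TGhost {R E}.
Arguments TZero {R E}.

Definition tsum_edges (R : comNzRingType) (E : digraph) (s : seq (edge E)) :
    lterm R E :=
  foldr (fun f t => TAdd (TMul (TEdge f) (TGhost f)) t) TZero s.

(* The least congruence containing the R-algebra axioms and the Leavitt path
   relations; in [lcong_CK] the list [s] enumerates the edges with source [v]
   without repetition, so such an [s] exists iff there are finitely many. *)
Inductive lcong (R : comNzRingType) (E : digraph) :
    lterm R E -> lterm R E -> Prop :=
| lcong_refl x : lcong x x
| lcong_sym x y : lcong x y -> lcong y x
| lcong_trans x y z : lcong x y -> lcong y z -> lcong x z
| lcong_add x x' y y' : lcong x x' -> lcong y y' -> lcong (TAdd x y) (TAdd x' y')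
| lcong_opp x x' : lcong x x' -> lcong (TOpp x) (TOpp x')
| lcong_scale k x x' : lcong x x' -> lcong (TScale k x) (TScale k x')
| lcong_mul x x' y y' : lcong x x' -> lcong y y' -> lcong (TMul x y) (TMul x' y')
| lcong_addA x y z : lcong (TAdd x (TAdd y z)) (TAdd (TAdd x y) z)
| lcong_addC x y : lcong (TAdd x y) (TAdd y x)
| lcong_add0 x : lcong (TAdd TZero x) x
| lcong_addN x : lcong (TAdd (TOpp x) x) TZero
| lcong_scaleA k l x : lcong (TScale k (TScale l x)) (TScale (k * l) x)
| lcong_scale1 x : lcong (TScale 1 x) x
| lcong_scaleDr k x y :
    lcong (TScale k (TAdd x y)) (TAdd (TScale k x) (TScale k y))
| lcong_scaleDl k l x :
    lcong (TScale (k + l) x) (TAdd (TScale k x) (TScale l x))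
| lcong_mulA x y z : lcong (TMul x (TMul y z)) (TMul (TMul x y) z)
| lcong_mulDl x y z : lcong (TMul (TAdd x y) z) (TAdd (TMul x z) (TMul y z))
| lcong_mulDr x y z : lcong (TMul x (TAdd y z)) (TAdd (TMul x y) (TMul x z))
| lcong_scaleAl k x y : lcong (TScale k (TMul x y)) (TMul (TScale k x) y)
| lcong_scaleAr k x y : lcong (TScale k (TMul x y)) (TMul x (TScale k y))
| lcong_vert_idem v : lcong (TMul (TVert v) (TVert v)) (TVert v)
| lcong_vert_orth v w : v != w -> lcong (TMul (TVert v) (TVert w)) TZero
| lcong_src_edge e : lcong (TMul (TVert (src e)) (TEdge e)) (TEdge e)
| lcong_edge_rng e : lcong (TMul (TEdge e) (TVert (rng e))) (TEdge e)
| lcong_rng_ghost e : lcong (TMul (TVert (rng e)) (TGhost e)) (TGhost e)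
| lcong_ghost_src e : lcong (TMul (TGhost e) (TVert (src e))) (TGhost e)
| lcong_ghost_edge e : lcong (TMul (TGhost e) (TEdge e)) (TVert (rng e))
| lcong_ghost_edge0 e f : e != f -> lcong (TMul (TGhost e) (TEdge f)) TZero
| lcong_CK v (s : seq (edge E)) :
    uniq s -> s != [::] -> (forall f, (f \in s) = (src f == v)) ->
    lcong (TVert v) (tsum_edges R s).

HB.instance Definition _ (R : comNzRingType) (E : digraph) :=
  gen_eqMixin (lterm R E).
HB.instance Definition _ (R : comNzRingType) (E : digraph) :=
  gen_choiceMixin (lterm R E).

Definition lcongb (R : comNzRingType) (E : digraph) (x y : lterm R E) : bool :=
  `[< lcong x y >].

Lemma lcongb_equiv (R : comNzRingType) (E : digraph) :
  equiv_class_of (@lcongb R E).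
Proof.
split=> [x|x y|y x z]; rewrite /lcongb.
- by apply/asboolP; apply: lcong_refl.
- by apply/asboolP/asboolP; apply: lcong_sym.
- move=> /asboolP xy /asboolP yz; apply/asboolP.
  exact: lcong_trans xy yz.
Qed.

Canonical lcong_equiv (R : comNzRingType) (E : digraph) :=
  EquivRelPack (@lcongb_equiv R E).

Definition leavitt (R : comNzRingType) (E : digraph) : Type :=
  {eq_quot (@lcong_equiv R E)}.

HB.instance Definition _ (R : comNzRingType) (E : digraph) :=
  Choice.on (leavitt R E).
HB.instance Definition _ (R : comNzRingType) (E : digraph) :=
  EqQuotient.on (leavitt R E).

Definition lpi (R : comNzRingType) (E : digraph) (x : lterm R E) : leavitt R E :=
  \pi_(leavitt R E) x.

Lemma lpi_eq (R : comNzRingType) (E : digraph) (x y : lterm R E) :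
  lpi x = lpi y <-> lcong x y.
Proof.
split=> [/eqP|xy].
  by rewrite /lpi eqmodE => /asboolP.
by apply/eqP; rewrite /lpi eqmodE; apply/asboolP.
Qed.

Lemma lpi_repr (R : comNzRingType) (E : digraph) (x : leavitt R E) :
  lpi (repr x) = x.
Proof. exact: reprK. Qed.

Lemma lpi_surj (R : comNzRingType) (E : digraph) (x : leavitt R E) :
  exists t, x = lpi t.
Proof. by exists (repr x); rewrite lpi_repr. Qed.

Lemma repr_lpi (R : comNzRingType) (E : digraph) (t : lterm R E) :
  lcong (repr (lpi t)) t.
Proof. by apply/lpi_eq; rewrite lpi_repr. Qed.

Definition ladd (R : comNzRingType) (E : digraph) (x y : leavitt R E) :=
  lpi (TAdd (repr x) (repr y)).
Definition lopp (R : comNzRingType) (E : digraph) (x : leavitt R E) :=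
  lpi (TOpp (repr x)).
Definition lscale (R : comNzRingType) (E : digraph) (k : R) (x : leavitt R E) :=
  lpi (TScale k (repr x)).
Definition lmul (R : comNzRingType) (E : digraph) (x y : leavitt R E) :=
  lpi (TMul (repr x) (repr y)).

Lemma laddE (R : comNzRingType) (E : digraph) (s t : lterm R E) :
  ladd (lpi s) (lpi t) = lpi (TAdd s t).
Proof. by apply/lpi_eq; apply: lcong_add; apply: repr_lpi. Qed.

Lemma loppE (R : comNzRingType) (E : digraph) (s : lterm R E) :
  lopp (lpi s) = lpi (TOpp s).
Proof. by apply/lpi_eq; apply: lcong_opp; apply: repr_lpi. Qed.

Lemma lscaleE (R : comNzRingType) (E : digraph) (k : R) (s : lterm R E) :
  lscale k (lpi s) = lpi (TScale k s).
Proof. by apply/lpi_eq; apply: lcong_scale; apply: repr_lpi. Qed.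

Lemma lmulE (R : comNzRingType) (E : digraph) (s t : lterm R E) :
  lmul (lpi s) (lpi t) = lpi (TMul s t).
Proof. by apply/lpi_eq; apply: lcong_mul; apply: repr_lpi. Qed.

Lemma laddA (R : comNzRingType) (E : digraph) : associative (@ladd R E).
Proof.
move=> x y z; have [a ->] := lpi_surj x; have [b ->] := lpi_surj y.
have [c ->] := lpi_surj z.
by rewrite !laddE; apply/lpi_eq; apply: lcong_addA.
Qed.

Lemma laddC (R : comNzRingType) (E : digraph) : commutative (@ladd R E).
Proof.
move=> x y; have [a ->] := lpi_surj x; have [b ->] := lpi_surj y.
by rewrite !laddE; apply/lpi_eq; apply: lcong_addC.
Qed.

Lemma ladd0 (R : comNzRingType) (E : digraph) :
  left_id (lpi TZero) (@ladd R E).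
Proof.
move=> x; have [a ->] := lpi_surj x.
by rewrite !laddE; apply/lpi_eq; apply: lcong_add0.
Qed.

Lemma laddN (R : comNzRingType) (E : digraph) :
  left_inverse (lpi TZero) (@lopp R E) (@ladd R E).
Proof.
move=> x; have [a ->] := lpi_surj x.
by rewrite loppE laddE; apply/lpi_eq; apply: lcong_addN.
Qed.

HB.instance Definition _ (R : comNzRingType) (E : digraph) :=
  GRing.isZmodule.Build (leavitt R E)
    (@laddA R E) (@laddC R E) (@ladd0 R E) (@laddN R E).

Lemma lpiD (R : comNzRingType) (E : digraph) (s t : lterm R E) :
  lpi (TAdd s t) = lpi s + lpi t.
Proof. by rewrite -laddE. Qed.

Lemma lpiN (R : comNzRingType) (E : digraph) (s : lterm R E) :
  lpi (TOpp s) = - lpi s.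
Proof. by rewrite -loppE. Qed.

Lemma lpi0 (R : comNzRingType) (E : digraph) : lpi TZero = 0 :> leavitt R E.
Proof. by []. Qed.

Lemma lscaleA (R : comNzRingType) (E : digraph) (k l : R) (x : leavitt R E) :
  lscale k (lscale l x) = lscale (k * l) x.
Proof.
have [a ->] := lpi_surj x.
by rewrite !lscaleE; apply/lpi_eq; apply: lcong_scaleA.
Qed.

Lemma lscale1 (R : comNzRingType) (E : digraph) : left_id 1 (@lscale R E).
Proof.
move=> x; have [a ->] := lpi_surj x.
by rewrite !lscaleE; apply/lpi_eq; apply: lcong_scale1.
Qed.

Lemma lscaleDr (R : comNzRingType) (E : digraph) :
  right_distributive (@lscale R E) +%R.
Proof.
move=> k x y; have [a ->] := lpi_surj x; have [b ->] := lpi_surj y.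
by rewrite -lpiD !lscaleE -lpiD; apply/lpi_eq; apply: lcong_scaleDr.
Qed.

Lemma lscaleDl (R : comNzRingType) (E : digraph) (x : leavitt R E) :
  {morph (@lscale R E)^~ x : k l / k + l}.
Proof.
move=> k l; have [a ->] := lpi_surj x.
by rewrite !lscaleE -lpiD; apply/lpi_eq; apply: lcong_scaleDl.
Qed.

HB.instance Definition _ (R : comNzRingType) (E : digraph) :=
  GRing.Zmodule_isLmodule.Build R (leavitt R E)
    (@lscaleA R E) (@lscale1 R E) (@lscaleDr R E) (@lscaleDl R E).

Lemma lpiZ (R : comNzRingType) (E : digraph) (k : R) (s : lterm R E) :
  lpi (TScale k s) = k *: lpi s.
Proof. by rewrite -lscaleE. Qed.

Lemma lmulA (R : comNzRingType) (E : digraph) : associative (@lmul R E).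
Proof.
move=> x y z; have [a ->] := lpi_surj x; have [b ->] := lpi_surj y.
have [c ->] := lpi_surj z.
by rewrite !lmulE; apply/lpi_eq; apply: lcong_mulA.
Qed.

Lemma lmulDl (R : comNzRingType) (E : digraph) :
  left_distributive (@lmul R E) +%R.
Proof.
move=> x y z; have [a ->] := lpi_surj x; have [b ->] := lpi_surj y.
have [c ->] := lpi_surj z.
by rewrite -lpiD !lmulE -lpiD; apply/lpi_eq; apply: lcong_mulDl.
Qed.

Lemma lmulDr (R : comNzRingType) (E : digraph) :
  right_distributive (@lmul R E) +%R.
Proof.
move=> x y z; have [a ->] := lpi_surj x; have [b ->] := lpi_surj y.
have [c ->] := lpi_surj z.
by rewrite -lpiD !lmulE -lpiD; apply/lpi_eq; apply: lcong_mulDr.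
Qed.

Lemma lscaleAl (R : comNzRingType) (E : digraph) (k : R) (x y : leavitt R E) :
  k *: lmul x y = lmul (k *: x) y.
Proof.
have [a ->] := lpi_surj x; have [b ->] := lpi_surj y.
by rewrite -lpiZ !lmulE -lpiZ; apply/lpi_eq; apply: lcong_scaleAl.
Qed.

Lemma lscaleAr (R : comNzRingType) (E : digraph) (k : R) (x y : leavitt R E) :
  k *: lmul x y = lmul x (k *: y).
Proof.
have [a ->] := lpi_surj x; have [b ->] := lpi_surj y.
by rewrite -lpiZ !lmulE -lpiZ; apply/lpi_eq; apply: lcong_scaleAr.
Qed.

HB.instance Definition _ (R : comNzRingType) (E : digraph) :=
  Lmodule_isNUAlgebra.Build R (leavitt R E)
    (@lmulA R E) (@lmulDl R E) (@lmulDr R E) (@lscaleAl R E) (@lscaleAr R E).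

Lemma lpiM (R : comNzRingType) (E : digraph) (s t : lterm R E) :
  lpi (TMul s t) = lpi s ** lpi t.
Proof. by rewrite -lmulE. Qed.

Lemma numul0 (R : comNzRingType) (A : nuAlgType R) (x : A) : x ** 0 = 0.
Proof. by apply: (addrI (x ** 0)); rewrite -numulDr !addr0. Qed.

Lemma nu0mul (R : comNzRingType) (A : nuAlgType R) (x : A) : 0 ** x = 0.
Proof. by apply: (addrI (0 ** x)); rewrite -numulDl !addr0. Qed.

Lemma lpi_tsum (R : comNzRingType) (E : digraph) (s : seq (edge E)) :
  lpi (tsum_edges R s) = \sum_(f <- s) lpi (TEdge f) ** lpi (TGhost f).
Proof.
by elim: s => [|f s IH]; rewrite ?big_nil // big_cons /= lpiD lpiM IH.
Qed.

Fixpoint tstar (R : comNzRingType) (E : digraph) (t : lterm R E) : lterm R E :=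
  match t with
  | TVert v => TVert v
  | TEdge e => TGhost e
  | TGhost e => TEdge e
  | TZero => TZero
  | TAdd x y => TAdd (tstar x) (tstar y)
  | TOpp x => TOpp (tstar x)
  | TScale k x => TScale k (tstar x)
  | TMul x y => TMul (tstar y) (tstar x)
  end.

Lemma tstarK (R : comNzRingType) (E : digraph) : involutive (@tstar R E).
Proof. by elim=> //= [x -> y ->|x ->|k x ->|x -> y ->]. Qed.

Lemma tstar_tsum (R : comNzRingType) (E : digraph) (s : seq (edge E)) :
  tstar (tsum_edges R s) = tsum_edges R s.
Proof. by elim: s => //= f s ->. Qed.

Lemma tstar_cong (R : comNzRingType) (E : digraph) (s t : lterm R E) :
  lcong s t -> lcong (tstar s) (tstar t).
Proof.
elim=> {s t} /=; try by constructor.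
- move=> x y z _ xy _ yz; exact: lcong_trans xy yz.
- by move=> x y z; apply: lcong_sym; apply: lcong_mulA.
- by move=> v w; rewrite eq_sym; apply: lcong_vert_orth.
- by move=> e f; rewrite eq_sym; apply: lcong_ghost_edge0.
- by move=> v s *; rewrite tstar_tsum; apply: lcong_CK.
Qed.

Definition lstar (R : comNzRingType) (E : digraph) (x : leavitt R E) :
  leavitt R E := lpi (tstar (repr x)).

Lemma lstarE (R : comNzRingType) (E : digraph) (s : lterm R E) :
  lstar (lpi s) = lpi (tstar s).
Proof. by apply/lpi_eq; apply: tstar_cong; apply: repr_lpi. Qed.

Lemma lstarD (R : comNzRingType) (E : digraph) :
  {morph @lstar R E : x y / x + y}.
Proof.
move=> x y; have [a ->] := lpi_surj x; have [b ->] := lpi_surj y.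
by rewrite -lpiD !lstarE -lpiD.
Qed.

Lemma lstarZ (R : comNzRingType) (E : digraph) (k : R) (x : leavitt R E) :
  lstar (k *: x) = k *: lstar x.
Proof. by have [a ->] := lpi_surj x; rewrite -lpiZ !lstarE -lpiZ. Qed.

Lemma lstarM (R : comNzRingType) (E : digraph) (x y : leavitt R E) :
  lstar (x ** y) = lstar y ** lstar x.
Proof.
have [a ->] := lpi_surj x; have [b ->] := lpi_surj y.
by rewrite -lpiM !lstarE -lpiM.
Qed.

Lemma lstarK (R : comNzRingType) (E : digraph) : involutive (@lstar R E).
Proof. by move=> x; have [a ->] := lpi_surj x; rewrite !lstarE tstarK. Qed.

HB.instance Definition _ (R : comNzRingType) (E : digraph) :=
  NUAlgebra_isStar.Build R (leavitt R E)
    (@lstarD R E) (@lstarZ R E) (@lstarM R E) (@lstarK R E).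

Definition lvert (R : comNzRingType) (E : digraph) (v : vertex E) :
  leavitt R E := lpi (TVert v).
Definition ledge (R : comNzRingType) (E : digraph) (e : edge E) :
  leavitt R E := lpi (TEdge e).
Definition lghost (R : comNzRingType) (E : digraph) (e : edge E) :
  leavitt R E := lpi (TGhost e).

Record leavitt_family (R : comNzRingType) (E : digraph) (A : nuAlgType R)
    (P : vertex E -> A) (S T : edge E -> A) : Prop := LeavittFamily {
  lf_idem : forall v, P v ** P v = P v;
  lf_orth : forall v w, v != w -> P v ** P w = 0;
  lf_src_edge : forall e, P (src e) ** S e = S e;
  lf_edge_rng : forall e, S e ** P (rng e) = S e;
  lf_rng_ghost : forall e, P (rng e) ** T e = T e;
  lf_ghost_src : forall e, T e ** P (src e) = T e;
  lf_ghost_edge : forall e f, T e ** S f = if e == f then P (rng e) else 0;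
  lf_CK : forall v (s : seq (edge E)),
    uniq s -> s != [::] -> (forall f, (f \in s) = (src f == v)) ->
    P v = \sum_(f <- s) S f ** T f
}.

Lemma leavitt_generators (R : comNzRingType) (E : digraph) :
  leavitt_family (@lvert R E) (@ledge R E) (@lghost R E).
Proof.
split=> [v|v w vw|e|e|e|e|e f|v s us s0 sE];
  rewrite /lvert /ledge /lghost -?lpiM -?lpi_tsum -?lpi0.
7: case: eqVneq => [<-|ef].
all: by apply/lpi_eq; constructor.
Qed.

Fixpoint teval (R : comNzRingType) (E : digraph) (A : nuAlgType R)
    (P : vertex E -> A) (S T : edge E -> A) (t : lterm R E) : A :=
  match t with
  | TVert v => P v
  | TEdge e => S e
  | TGhost e => T e
  | TZero => 0
  | TAdd x y => teval P S T x + teval P S T y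
  | TOpp x => - teval P S T x
  | TScale k x => k *: teval P S T x
  | TMul x y => teval P S T x ** teval P S T y
  end.

Lemma teval_cong (R : comNzRingType) (E : digraph) (A : nuAlgType R)
    (P : vertex E -> A) (S T : edge E -> A) (s t : lterm R E) :
  leavitt_family P S T -> lcong s t -> teval P S T s = teval P S T t.
Proof.
move=> F; elim=> {s t} //=; try by move=> *; congruence.
- by move=> *; rewrite addrA.
- by move=> *; rewrite addrC.
- by move=> *; rewrite add0r.
- by move=> *; rewrite addNr.
- by move=> *; rewrite scalerA.
- by move=> *; rewrite scale1r.
- by move=> *; rewrite scalerDr.
- by move=> *; rewrite scalerDl.
- by move=> *; rewrite numulA.
- by move=> *; rewrite numulDl.
- by move=> *; rewrite numulDr.
- by move=> *; rewrite nuscalerAl.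
- by move=> *; rewrite nuscalerAr.
- exact: (lf_idem F).
- exact: (lf_orth F).
- exact: (lf_src_edge F).
- exact: (lf_edge_rng F).
- exact: (lf_rng_ghost F).
- exact: (lf_ghost_src F).
- by move=> e; rewrite (lf_ghost_edge F) eqxx.
- by move=> e f /negPf ef; rewrite (lf_ghost_edge F) ef.
- move=> v s us s0 sE; rewrite (lf_CK F us s0 sE).
  elim: (s) => [|f r IH]; first by rewrite big_nil.
  by rewrite big_cons /= IH.
Qed.

Lemma leavitt_universal (R : comNzRingType) (E : digraph) (A : nuAlgType R)
    (P : vertex E -> A) (S T : edge E -> A) :
  leavitt_family P S T ->
  exists! f : leavitt R E -> A,
    [/\ linear f, {morph f : x y / x ** y},
        forall v, f (lvert R v) = P v,
        forall e, f (ledge R e) = S e &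
        forall e, f (lghost R e) = T e].
Proof.
move=> F; pose f (x : leavitt R E) := teval P S T (repr x).
have fE t : f (lpi t) = teval P S T t.
  exact: teval_cong F (repr_lpi t).
exists f; split.
  split=> [k x y|x y|v|e|e]; try exact: fE.
  have [a ->] := lpi_surj x; have [b ->] := lpi_surj y.
  by rewrite -lpiZ -lpiD !fE.
move=> g [glin gM gv ge gg].
have gD x y : g (x + y) = g x + g y.
  by have := glin 1 x y; rewrite !scale1r.
have g0 : g 0 = 0 by apply: (addrI (g 0)); rewrite -gD !addr0.
have gZ k x : g (k *: x) = k *: g x.
  by have := glin k x 0; rewrite !addr0 g0 addr0.
apply: funext => x; have [t ->] := lpi_surj x; rewrite fE.
elim: t => [v|e|e||s IHs t IHt|s IHs|k s IHs|s IHs t IHt] /=.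
- by rewrite -gv.
- by rewrite -ge.
- by rewrite -gg.
- by rewrite lpi0 g0.
- by rewrite lpiD gD -IHs -IHt.
- by rewrite lpiN -[- lpi s]scaleN1r gZ -IHs scaleN1r.
- by rewrite lpiZ gZ -IHs.
- by rewrite lpiM gM -IHs -IHt.
Qed.

Lemma lstar_vert (R : comNzRingType) (E : digraph) (v : vertex E) :
  star (lvert R v) = lvert R v.
Proof. exact: lstarE. Qed.

Lemma lstar_edge (R : comNzRingType) (E : digraph) (e : edge E) :
  star (ledge R e) = lghost R e.
Proof. exact: lstarE. Qed.

Lemma lstar_ghost (R : comNzRingType) (E : digraph) (e : edge E) :
  star (lghost R e) = ledge R e.
Proof. exact: lstarE. Qed.

(* Meaningful only when there are finitely many vertices: [\sum_(_ \in _)] is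
   0 on infinite supports. If there are no vertices, the algebra and [lone] are
   both zero. *)
Definition lone (R : comNzRingType) (E : digraph) : leavitt R E :=
  \sum_(v \in [set: vertex E]) lvert R v.

Lemma lone_unit (R : comNzRingType) (E : digraph) :
  finite_set [set: vertex E] ->
  forall x : leavitt R E, lone R E ** x = x /\ x ** lone R E = x.
Proof.
move=> /finite_seqP[s0 s0E]; pose r := undup s0.
have mem_r v : v \in r.
  have : [set: vertex E] v by [].
  by rewrite s0E mem_undup.
have ur : uniq r by exact: undup_uniq.
have oneE : lone R E = \sum_(v <- r) lvert R v.
  rewrite fsbig_seq // /lone; congr (\sum_(v \in _) _).
  by apply/seteqP; split=> v //= _; exact: mem_r.
have G := leavitt_generators R E.
have suml (y : leavitt R E) : lone R E ** y = \sum_(v <- r) lvert R v ** y.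
  rewrite oneE; elim: (r) => [|v s IH]; first by rewrite !big_nil nu0mul.
  by rewrite !big_cons numulDl IH.
have sumr (y : leavitt R E) : y ** lone R E = \sum_(v <- r) y ** lvert R v.
  rewrite oneE; elim: (r) => [|v s IH]; first by rewrite !big_nil numul0.
  by rewrite !big_cons numulDr IH.
have onel v y : lvert R v ** y = y -> lone R E ** y = y.
  move=> vy; rewrite suml (bigD1_seq v) //= vy big1 ?addr0 // => w wv.
  by rewrite -vy numulA (lf_orth G wv) nu0mul.
have oner v y : y ** lvert R v = y -> y ** lone R E = y.
  move=> yv; rewrite sumr (bigD1_seq v) //= yv big1 ?addr0 // => w.
  rewrite eq_sym => wv.
  by rewrite -yv -numulA (lf_orth G wv) numul0.
move=> x; have [t ->] := lpi_surj x.
elim: t => [v|e|e||s [sl sr] t [tl tr]|s [sl sr]|k s [sl sr]|s [sl sr] t [tl tr]].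
- by split; [apply: (onel v)|apply: (oner v)]; apply: (lf_idem G).
- split; [apply: (onel (src e))|apply: (oner (rng e))].
  + exact: (lf_src_edge G).
  + exact: (lf_edge_rng G).
- split; [apply: (onel (rng e))|apply: (oner (src e))].
  + exact: (lf_rng_ghost G).
  + exact: (lf_ghost_src G).
- by rewrite lpi0 numul0 nu0mul.
- by rewrite lpiD numulDl numulDr sl sr tl tr.
- by rewrite lpiN -scaleN1r -nuscalerAl -nuscalerAr sl sr.
- by rewrite lpiZ -nuscalerAl -nuscalerAr sl sr.
- by rewrite lpiM numulA sl -numulA tr.
Qed.

(* One vertex and two loops; the loop [true] is a, the loop [false] is b. *)
Definition rose2 : digraph :=
  @Digraph unit bool (fun=> tt) (fun=> tt).

Notation L2 R := (leavitt R rose2).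

Lemma lone_rose2 (R : comNzRingType) : lone R rose2 = lvert R (tt : vertex rose2).
Proof.
have -> : lvert R (tt : vertex rose2) =
    \sum_(v \in [set (tt : vertex rose2)]) lvert R v by rewrite fsbig_set1.
by rewrite /lone; congr (\sum_(v \in _) _); apply/seteqP; split=> [[]|].
Qed.

Lemma L2_relations (R : comNzRingType) :
  let a : L2 R := ledge R (true : edge rose2) in
  let b : L2 R := ledge R (false : edge rose2) in
  [/\ star a ** a = lone R rose2, star b ** b = lone R rose2 &
      a ** star a + b ** star b = lone R rose2].
Proof.
have G := leavitt_generators R rose2.
rewrite /= !lstar_edge lone_rose2; split.
- exact: (lf_ghost_edge G true true).
- exact: (lf_ghost_edge G false false).
- rewrite (lf_CK G (v := tt) (s := [:: true; false])) //; last by case.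
  by rewrite !big_cons big_nil addr0.
Qed.

(* Main.v *)
(** For countable E, choose prefix codes w_v (v a vertex) and, for each v, u_e
    (s(e) = v), complete when finite and nonempty, and map v to W_v W_v^* and e
    to W_{s(e)} U_e U W_{r(e)}^*, where U is the unitary of L_2 that moves the
    Cantor set by 0w -> 00w, 10w -> 01w, 11w -> 1w. Let L_2 act on functions on
    the natural numbers through n -> 2n and n -> 2n + 1. On the numbers n > 0
    that are not 3 modulo 4, every U_e U acts by a map that strictly increases
    n, even when v emits a single edge and U_e = 1; hence distinct paths ending
    at v move a given point to distinct points, and the images of the real
    paths ending at v are linearly independent. An arbitrary element of the
    kernel is reduced to this case by multiplying by edges on the right.

    For uncountable E, the vertices or the edges form an uncountable linearly
    independent set, whereas L_2 is spanned by countably many monomials. An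
    embedding would send infinitely many independent elements into the span of
    one finite set of monomials, against the strong rank condition for the
    commutative ring R. *)
Require Import Defs.
From mathcomp Require Import all_boot all_algebra.
From mathcomp Require Import boolp classical_sets cardinality fsbigop.
From mathcomp Require Import zify.

Set Implicit Arguments.
Unset Strict Implicit.
Unset Printing Implicit Defensive.

Import GRing.Theory.
Local Open Scope ring_scope.
Local Open Scope classical_set_scope.

(** * Finite sums in nonunital algebras *)

Lemma partition_big_map (V : nmodType) (I J : eqType) (h : I -> J)
    (g : I -> V) (s : seq I) :
  \sum_(i <- s) g i =
  \sum_(j <- undup (map h s)) \sum_(i <- s | h i == j) g i.
Proof.
under [RHS]eq_bigr do rewrite big_mkcond.
rewrite exchange_big [LHS]big_seq [RHS]big_seq; apply: eq_bigr => i si.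
rewrite (bigD1_seq (h i)) ?undup_uniq ?mem_undup ?map_f //= eqxx.
by rewrite big1 ?addr0 // => j; rewrite eq_sym => /negPf->.
Qed.

Section NonunitalAlgebra.
Variables (R : comNzRingType) (A : nuAlgType R).
Implicit Types x y : A.

Lemma numul_suml (I : Type) (s : seq I) (P : pred I) (F : I -> A) y :
  (\sum_(i <- s | P i) F i) ** y = \sum_(i <- s | P i) F i ** y.
Proof. by elim/big_rec2: _ => [|i u v _ <-]; rewrite ?nu0mul ?numulDl. Qed.

Lemma numul_sumr (I : Type) (s : seq I) (P : pred I) (F : I -> A) y :
  y ** (\sum_(i <- s | P i) F i) = \sum_(i <- s | P i) y ** F i.
Proof. by elim/big_rec2: _ => [|i u v _ <-]; rewrite ?numul0 ?numulDr. Qed.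

Lemma numulNl x y : (- x) ** y = - (x ** y).
Proof. by rewrite -scaleN1r -nuscalerAl scaleN1r. Qed.

End NonunitalAlgebra.

Lemma star0 (R : comNzRingType) (A : starAlgType R) : star (0 : A) = 0.
Proof. by rewrite -(scale0r (0 : A)) starZ !scale0r. Qed.

(* A partition of [X] into sets [X_v], indexed by the vertices, with injections
   [push e : X_(rng e) -> X_(src e)] of pairwise disjoint ranges, which cover
   [X_v] when [v] is neither a sink nor an infinite emitter; [pull] is the
   common partial inverse of the injections. *)
Record branching (E : digraph) (X : Type) := Branching {
  loc : X -> vertex E;
  push : edge E -> X -> X;
  pull : X -> option (edge E * X);
  loc_push : forall e x, loc x = rng e -> loc (push e x) = src e;
  pushK : forall e x, loc x = rng e -> pull (push e x) = Some (e, x);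
  pullK : forall x e y, pull x = Some (e, y) -> push e y = x /\ loc y = rng e;
  pull_regular : forall x s, uniq s -> s != [::] ->
    (forall f, (f \in s) = (src f == loc x)) -> exists p, pull x = Some p
}.
Arguments loc_push {E X b e x}.
Arguments pushK {E X b e x}.
Arguments pullK {E X b x e y}.
Arguments pull_regular {E X b x s}.

(** * The action of a Leavitt path algebra on the functions on a branching system *)

Section BranchingAction.
Variables (R : comNzRingType) (E : digraph) (X : Type) (B : branching E X).
Implicit Types (phi psi : X -> R) (s t : lterm R E).

Fixpoint term_act t phi : X -> R :=
  match t with
  | TVert v => fun x => if loc B x == v then phi x else 0
  | TEdge e => fun x =>
      if pull B x is Some (f, y) then if f == e then phi y else 0 else 0
  | TGhost e => fun x => if loc B x == rng e then phi (push B e x) else 0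
  | TZero => fun=> 0
  | TAdd s t => fun x => term_act s phi x + term_act t phi x
  | TOpp s => fun x => - term_act s phi x
  | TScale k s => fun x => k * term_act s phi x
  | TMul s t => term_act s (term_act t phi)
  end.

Lemma term_act_linear t k phi psi :
  term_act t (fun x => k * phi x + psi x) =
  (fun x => k * term_act t phi x + term_act t psi x).
Proof.
apply: funext; elim: t k phi psi
  => [v|e|e||s IHs t IHt|s IHs|l s IHs|s IHs t IHt] k phi psi x /=.
- by case: ifP; rewrite ?mulr0 ?addr0.
- by case: (pull B x) => [[f y]|]; [case: ifP|]; rewrite ?mulr0 ?addr0.
- by case: ifP; rewrite ?mulr0 ?addr0.
- by rewrite mulr0 addr0.
- by rewrite IHs IHt mulrDr addrACA.
- by rewrite IHs opprD mulrN.
- by rewrite IHs mulrDr mulrCA.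
- by rewrite (funext (IHt k phi psi)) IHs.
Qed.

Lemma term_act0 t : term_act t (fun=> 0) = fun=> 0.
Proof.
have := term_act_linear t (-1) (fun=> 0) (fun=> 0).
under [X in term_act t X]eq_fun do rewrite mulr0 addr0.
by move=> E0; apply: funext => x; rewrite E0 mulN1r addNr.
Qed.

Lemma term_actD t phi psi : term_act t (fun x => phi x + psi x) =
  (fun x => term_act t phi x + term_act t psi x).
Proof.
have := term_act_linear t 1 phi psi.
under [X in term_act t X]eq_fun do rewrite mul1r.
by move=> ->; apply: funext => x; rewrite mul1r.
Qed.

Lemma term_actZ t k phi :
  term_act t (fun x => k * phi x) = (fun x => k * term_act t phi x).
Proof.
have := term_act_linear t k phi (fun=> 0).
under [X in term_act t X]eq_fun do rewrite addr0.
by move=> ->; apply: funext => x; rewrite term_act0 addr0.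
Qed.

Lemma loc_pull x e y : pull B x = Some (e, y) -> loc B x = src e.
Proof. by move=> /pullK[<-]; exact: loc_push. Qed.

(** Each [e e^*] acts as the projection onto the range of [push e]. These ranges are disjoint, so
    without repetitions in [r] no point is counted twice. *)
Lemma term_act_tsum (r : seq (edge E)) phi x : uniq r ->
  term_act (tsum_edges R r) phi x =
  if pull B x is Some (f, y) then if f \in r then phi x else 0 else 0.
Proof.
case px: (pull B x) => [[f y]|]; last first.
  by elim: r => //= e r IH /andP[_ ur]; rewrite px IH // add0r.
have [pfy lfy] := pullK px.
elim: r => //= e r IH /andP[er ur]; rewrite px IH // in_cons.
have [fe|_] := eqVneq f e; last by rewrite add0r.
by rewrite -fe lfy eqxx pfy {1}fe (negPf er) addr0.
Qed.

(** This lets the action descend to the quotient. Linearity of the operators yields the algebra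
    axioms that concern the right factor of a product; [pull_regular] yields the Cuntz-Krieger
    relation. *)
Lemma term_act_cong s t : lcong s t -> term_act s = term_act t.
Proof.
suff actE : lcong s t -> forall phi, term_act s phi = term_act t phi.
  by move=> st; apply: funext; exact: actE.
elim=> {s t} //=.
- by move=> x y z _ xy _ yz phi; rewrite xy.
- by move=> x x' y y' _ xx' _ yy' phi; rewrite xx' yy'.
- by move=> x x' _ xx' phi; rewrite xx'.
- by move=> k x x' _ xx' phi; rewrite xx'.
- by move=> x x' y y' _ xx' _ yy' phi; rewrite yy' xx'.
- by move=> *; apply: funext => ?; rewrite addrA.
- by move=> *; apply: funext => ?; rewrite addrC.
- by move=> *; apply: funext => ?; rewrite add0r.
- by move=> *; apply: funext => ?; rewrite addNr.
- by move=> *; apply: funext => ?; rewrite mulrA.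
- by move=> *; apply: funext => ?; rewrite mul1r.
- by move=> *; apply: funext => ?; rewrite mulrDr.
- by move=> *; apply: funext => ?; rewrite mulrDl.
- by move=> x y z phi; rewrite term_actD.
- by move=> k x y phi; rewrite term_actZ.
- by move=> v phi; apply: funext => x; case: (loc B x == v).
- move=> v w vw phi; apply: funext => x; case: eqP => // ->.
  by rewrite (negPf vw).
- move=> e phi; apply: funext => x; case px: (pull B x) => [[f y]|]; last first.
    by rewrite if_same.
  have [fe|_] := eqVneq f e; last by rewrite if_same.
  by rewrite (loc_pull px) fe eqxx.
- move=> e phi; apply: funext => x; case px: (pull B x) => [[f y]|] //.
  by have [<-|//] := eqVneq f e; have [_ ->] := pullK px; rewrite eqxx.
- by move=> e phi; apply: funext => x; case: (loc B x == rng e).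
- move=> e phi; apply: funext => x; case: eqP => // xe.
  by rewrite loc_push // eqxx.
- move=> e phi; apply: funext => x; case: eqP => // xe.
  by rewrite pushK // eqxx.
- move=> e f ef phi; apply: funext => x; case: eqP => // xe.
  by rewrite pushK // (negPf ef).
- move=> v r ur r0 rE phi; apply: funext => x; rewrite term_act_tsum //.
  have [xv|xv] := eqVneq (loc B x) v.
    have [|[f y] px] := pull_regular (b := B) (x := x) ur r0.
      by move=> f; rewrite rE xv.
    by rewrite px rE -(loc_pull px) xv eqxx.
  case px: (pull B x) => [[f y]|] //.
  by rewrite rE -(loc_pull px) (negPf xv).
Qed.

Definition leavitt_act (x : leavitt R E) : (X -> R) -> X -> R :=
  term_act (repr x).

Lemma leavitt_act_lpi t : leavitt_act (lpi t) = term_act t.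
Proof. exact: term_act_cong (repr_lpi t). Qed.

Lemma leavitt_actM (x y : leavitt R E) phi :
  leavitt_act (x ** y) phi = leavitt_act x (leavitt_act y phi).
Proof. by rewrite [x ** y]/(lpi _) leavitt_act_lpi. Qed.

Lemma leavitt_actD (x y : leavitt R E) phi z :
  leavitt_act (x + y) phi z = leavitt_act x phi z + leavitt_act y phi z.
Proof. by rewrite [x + y]/(lpi _) leavitt_act_lpi. Qed.

Lemma leavitt_actZ k (x : leavitt R E) phi z :
  leavitt_act (k *: x) phi z = k * leavitt_act x phi z.
Proof. by rewrite [k *: x]/(lpi _) leavitt_act_lpi. Qed.

Lemma leavitt_act0 phi z : leavitt_act 0 phi z = 0.
Proof. by rewrite -lpi0 leavitt_act_lpi. Qed.

End BranchingAction.

(** * The Leavitt algebra of type (1,2) *)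

Section Leavitt2.
Variable R : comNzRingType.
Implicit Types (x y : L2 R) (b c : bool) (u w : seq bool) (m n : nat).

Definition loop b : L2 R := ledge R (b : edge rose2).
Definition coloop b : L2 R := lghost R (b : edge rose2).

Lemma mul1L2 x : lone R rose2 ** x = x.
Proof. by case: (@lone_unit R rose2 (@finite_finset unit _) x). Qed.

Lemma mulL21 x : x ** lone R rose2 = x.
Proof. by case: (@lone_unit R rose2 (@finite_finset unit _) x). Qed.

Lemma star_loneL2 : star (lone R rose2) = lone R rose2.
Proof. by rewrite lone_rose2 lstar_vert. Qed.

Lemma star_loop b : star (loop b) = coloop b.
Proof. exact: lstar_edge. Qed.

Lemma star_coloop b : star (coloop b) = loop b.
Proof. exact: lstar_ghost. Qed.

Lemma coloopK b c : coloop b ** loop c = if b == c then lone R rose2 else 0.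
Proof.
by rewrite lone_rose2; apply: (lf_ghost_edge (leavitt_generators R rose2)).
Qed.

Lemma coloopMK b c x : coloop b ** (loop c ** x) = if b == c then x else 0.
Proof. by rewrite numulA coloopK; case: ifP; rewrite ?mul1L2 ?nu0mul. Qed.

Lemma loops_complete :
  loop false ** coloop false + loop true ** coloop true = lone R rose2.
Proof. by have [_ _] := L2_relations R; rewrite !lstar_edge addrC. Qed.

Lemma loops_completeM x :
  loop false ** (coloop false ** x) + loop true ** (coloop true ** x) = x.
Proof. by rewrite !numulA -numulDl loops_complete mul1L2. Qed.

(** * Isometries of words and prefix codes *)

Definition wordL2 w : L2 R := foldr (fun b x => loop b ** x) (lone R rose2) w.
Definition word_proj w : L2 R := wordL2 w ** star (wordL2 w).

Lemma wordL2_cat u w : wordL2 (u ++ w) = wordL2 u ** wordL2 w.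
Proof. by elim: u => [|b u IH] /=; rewrite ?mul1L2 // IH numulA. Qed.

Lemma wordL2K w : star (wordL2 w) ** wordL2 w = lone R rose2.
Proof.
elim: w => [|b w IH] /=; first by rewrite star_loneL2 mul1L2.
by rewrite starM star_loop -numulA coloopMK eqxx.
Qed.

Lemma wordL2_orth u b c v w : b != c ->
  star (wordL2 (u ++ b :: v)) ** wordL2 (u ++ c :: w) = 0.
Proof.
move=> /negPf bc; rewrite !wordL2_cat starM -numulA [X in _ ** X]numulA wordL2K.
by rewrite mul1L2 starM star_loop -numulA coloopMK bc numul0.
Qed.

(** The words 0^n 1 form an infinite prefix code; the first n of them together with 0^n form a
    finite complete one. *)
Definition comb_word n := rcons (nseq n false) true.

Lemma comb_word_orth_nseq m n : (m < n)%N ->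
  star (wordL2 (comb_word m)) ** wordL2 (nseq n false) = 0.
Proof.
move=> mn; rewrite /comb_word -cats1 -(subnKC mn) addSnnS nseqD.
exact: wordL2_orth.
Qed.

Lemma comb_word_orth m n : m != n ->
  star (wordL2 (comb_word m)) ** wordL2 (comb_word n) = 0.
Proof.
wlog mn : m n / (m < n)%N.
  move=> W; rewrite neq_ltn => /orP[mn|nm]; first by apply: W; rewrite ?ltn_eqF.
  by rewrite -[LHS]starK starM starK W ?star0 // ltn_eqF.
by rewrite {2}/comb_word -cats1 wordL2_cat numulA comb_word_orth_nseq // nu0mul.
Qed.

Lemma word_proj_rcons w b : word_proj (rcons w b) =
  wordL2 w ** (loop b ** (coloop b ** star (wordL2 w))).
Proof.
by rewrite /word_proj -cats1 wordL2_cat /= mulL21 starM star_loop !numulA.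
Qed.

(** By induction: the projection of 0^n splits into those of 0^n 1 and 0^(n+1). *)
Lemma comb_word_complete n :
  \sum_(i < n) word_proj (comb_word i) + word_proj (nseq n false) =
  lone R rose2.
Proof.
elim: n => [|n IH].
  by rewrite big_ord0 add0r /word_proj /= star_loneL2 mul1L2.
rewrite -{}IH big_ord_recr -addrA; congr (_ + _).
have -> : nseq n.+1 false = rcons (nseq n false) false.
  by rewrite -cats1 -[[:: false]]/(nseq 1 false) -nseqD addn1.
rewrite !word_proj_rcons -numulDr addrC.
by rewrite loops_completeM.
Qed.

(* [n] stands for its binary expansion, least significant digit first, so that
   [nat] is the set of the eventually zero points of the Cantor set. *)
Definition nat_branching : branching rose2 nat.
Proof.
apply: (@Branching rose2 nat (fun=> tt) (fun b n => (b : bool) + n.*2)%N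
  (fun n => Some (odd n, n./2))) => //.
- by move=> b n _; rewrite oddD odd_double addbF oddb half_bit_double.
- by move=> n b m [<- <-]; rewrite odd_double_half.
- by move=> n *; exists (odd n, n./2).
Defined.

Definition natact x : (nat -> R) -> nat -> R := leavitt_act nat_branching x.

Definition delta m : nat -> R := fun n => (n == m)%:R.

Lemma delta_inj : injective delta.
Proof.
move=> m n /(congr1 (@^~ m)); rewrite /delta eqxx.
by case: eqP => // _ /eqP; rewrite oner_eq0.
Qed.

Lemma natact_0r x : natact x (fun=> 0) = fun=> 0.
Proof. exact: term_act0. Qed.

Lemma natactM x y phi : natact (x ** y) phi = natact x (natact y phi).
Proof. exact: leavitt_actM. Qed.

Lemma natactD x y phi n :
  natact (x + y) phi n = natact x phi n + natact y phi n.
Proof. exact: leavitt_actD. Qed.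

Lemma natactZ k x phi n : natact (k *: x) phi n = k * natact x phi n.
Proof. exact: leavitt_actZ. Qed.

Lemma natact0 phi : natact 0 phi = fun=> 0.
Proof. by apply: funext => n; exact: leavitt_act0. Qed.

Lemma natact_lone phi : natact (lone R rose2) phi = phi.
Proof. by rewrite lone_rose2 /natact leavitt_act_lpi. Qed.

Lemma natact_loop b m : natact (loop b) (delta m) = delta (b + m.*2).
Proof.
rewrite /natact leavitt_act_lpi; apply: funext => n /=; rewrite /delta.
have -> : (n == b + m.*2)%N = (odd n == b) && (n./2 == m).
  apply/eqP/andP => [->|[/eqP <- /eqP <-]]; last by rewrite odd_double_half.
  by rewrite oddD odd_double addbF oddb half_bit_double !eqxx.
by case: (odd n == b).
Qed.

Lemma natact_coloop b m : natact (coloop b) (delta m) =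
  if odd m == b then delta m./2 else fun=> 0.
Proof.
rewrite /natact leavitt_act_lpi; apply: funext => n /=; rewrite /delta.
have -> : (b + n.*2 == m)%N = (odd m == b) && (n == m./2).
  apply/eqP/andP => [<-|[/eqP <- /eqP ->]]; last by rewrite odd_double_half.
  by rewrite oddD odd_double addbF oddb half_bit_double !eqxx.
by case: (odd m == b).
Qed.

(** In binary, [w] is prefixed to the digits of [n], its first letter becoming the lowest digit. *)
Definition wordN w n := foldr (fun b m => b + m.*2)%N n w.

Lemma natact_word w n : natact (wordL2 w) (delta n) = delta (wordN w n).
Proof.
elim: w => [|b w IH] /=; first by rewrite natact_lone.
by rewrite natactM IH natact_loop.
Qed.

Lemma leq_wordN w n : (n <= wordN w n)%N.
Proof. by elim: w => //= b w IH; lia. Qed.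

(* The unitary [expand] below maps such an [n] to [delta] of a larger even
   number. *)
Definition expanding n := ((0 < n) && (n %% 4 != 3))%N.

(** A number that is 3 modulo 4 has 11 as its lowest digits. The words 0^m and 0^m 1, selected by
    [b], contain at most one 1, and the digit of [n] that follows is 0. *)
Lemma wordN_comb m b n : (0 < n)%N -> ~~ odd n ->
  expanding (wordN (nseq m false ++ nseq b true) n).
Proof.
rewrite /expanding => n0 n2; elim: m => [|m IH] /=; last by lia.
by case: b => /=; lia.
Qed.

(** An infinite [A] receives the words 0^n 1 through an injection into the numbers; a finite one
    receives a complete code. The last clause is vacuous for infinite [A], since a list [s]
    enumerates [A] there. *)
Lemma exists_words (T : choiceType) (A : set T) : countable A ->
  exists w : T -> seq bool, [/\
    forall t n, (0 < n)%N -> ~~ odd n -> expanding (wordN (w t) n),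
    forall t t', A t -> A t' -> t != t' ->
      star (wordL2 (w t)) ** wordL2 (w t') = 0 &
    forall s, uniq s -> s != [::] -> (forall t, t \in s <-> A t) ->
      \sum_(t <- s) word_proj (w t) = lone R rose2].
Proof.
move=> cA; have [fA|nfA] := pselect (finite_set A); last first.
  have /countable_injP[f fI] := cA.
  exists (comb_word \o f); split=> [t n n0 n2|t t' At At' tt'|s _ _ sA].
  - by rewrite /comb_word /= -cats1; apply: (@wordN_comb _ true).
  - apply: comb_word_orth; apply: contraNneq tt' => ft.
    by apply/eqP/fI; rewrite ?inE.
  - exfalso; apply: nfA; apply/finite_seqP; exists s.
    by apply/seteqP; split=> t /=; rewrite sA.
have /finite_seqP[s0 s0A] := fA.
pose r := undup s0.
have rA t : t \in r <-> A t by rewrite mem_undup s0A.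
(* The last element receives 0^i instead of 0^i 1, which completes the code; for a singleton this is
   the empty word. *)
pose w t := let i := index t r in
  if i.+1 == size r then nseq i false else comb_word i.
exists w; split=> [t n n0 n2|t t' /rA tr /rA t'r tt'|s us s0' sA].
- rewrite /w /=; case: ifP => _; last first.
    by rewrite /comb_word -cats1; apply: (@wordN_comb _ true).
  by rewrite -[nseq _ _]cats0; apply: (@wordN_comb _ false).
- have : index t r != index t' r.
    by apply: contraNneq tt' => tt'; rewrite -(nth_index t tr) tt' nth_index.
  rewrite -index_mem in tr; rewrite -index_mem in t'r.
  rewrite /w /=; case: ifP => [/eqP it|_]; case: ifP => [/eqP it'|_] ii.
  + by move: ii; rewrite -eqSS it it' eqxx.
  + rewrite -[LHS]starK starM starK comb_word_orth_nseq ?star0 //.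
    by rewrite ltn_neqAle -ltnS it t'r eq_sym ii.
  + rewrite comb_word_orth_nseq //.
    by rewrite ltn_neqAle -ltnS it' tr ii.
  + exact: comb_word_orth.
- have sr : perm_eq s r.
    apply: uniq_perm; rewrite ?undup_uniq // => t.
    by apply/idP/idP => [/sA/rA|/rA/sA].
  rewrite (perm_big _ sr) /=; have ur : uniq r by exact: undup_uniq.
  have [t0 [n rn]] : exists (t0 : T) n, size r = n.+1.
    have : s != [::] by [].
    case: (s) (perm_size sr) => // t0 s' <- _.
    by exists t0, (size s').
  rewrite (big_nth t0) big_mkord rn big_ord_recr -[RHS](comb_word_complete n).
  congr (_ + _); last by rewrite /w index_uniq ?rn ?eqxx.
  apply: eq_bigr => i _; have ir : (i < size r)%N by rewrite rn ltnS ltnW.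
  by rewrite /w index_uniq // rn eqSS ltn_eqF /=.
Qed.

End Leavitt2.

(** * The unitary U and its effect on numbers *)

Section ExpandingUnitary.
Variable R : comNzRingType.
Implicit Types (x y : L2 R) (m n : nat).

(* The homeomorphism [0w -> 00w], [10w -> 01w], [11w -> 1w] of the Cantor
   set. *)
Definition expand : L2 R :=
  loop R false ** (loop R false ** coloop R false) +
  loop R false ** (loop R true ** (coloop R false ** coloop R true)) +
  loop R true ** (coloop R true ** coloop R true).

Lemma star_expand : star expand =
  loop R false ** (coloop R false ** coloop R false) +
  loop R true ** (loop R false ** (coloop R true ** coloop R false)) +
  loop R true ** (loop R true ** coloop R true).
Proof. by rewrite !(starD, starM, star_loop, star_coloop) -!numulA. Qed.

Let simp := (@numulDl R (L2 R), @numulDr R (L2 R), @coloopMK R, @coloopK R,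
  @mul1L2 R, @mulL21 R, @numul0 R (L2 R), @nu0mul R (L2 R), @add0r (L2 R),
  @addr0 (L2 R)).

Lemma expandK : star expand ** expand = lone R rose2.
Proof.
rewrite star_expand !simp -!numulA !simp /= ?simp.
by rewrite -addrA -!numulDr loops_completeM loops_complete.
Qed.

Lemma expandVK : expand ** star expand = lone R rose2.
Proof.
rewrite star_expand !simp -!numulA !simp /= ?simp.
by rewrite -!numulDr loops_completeM loops_complete.
Qed.

(** On digits, 0w -> 00w doubles an even number and 10w -> 01w adds 1 to a number that is 1 modulo
    4. The predicate [expanding] excludes the shortening case 11w -> 1w and the fixed point 0. *)
Definition expandN n := if odd n then n.+1 else n.*2.

Lemma natact_expand n : expanding n ->
  natact expand (delta R n) = delta R (expandN n).
Proof.
move=> /andP[n0 n3]; apply: funext => k; rewrite !natactD !natactM /expandN.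
rewrite !natact_coloop; case on: (odd n) => /=.
  have n2 : odd n./2 = false by lia.
  rewrite natact_coloop n2 /= !natact_0r natact_coloop n2 /= !natact_0r.
  by rewrite !natact_loop add0r addr0; congr (delta _ _ _); lia.
by rewrite !natact_0r !natact_loop !addr0; congr (delta _ _ _); lia.
Qed.

Lemma expandN_gt n : expanding n -> (n < expandN n)%N.
Proof. by rewrite /expanding /expandN; case: ifP => on; lia. Qed.

(** Evenness is what the code words require in order to return an expanding number, so that steps
    can be iterated. *)
Lemma odd_expandN n : odd (expandN n) = false.
Proof. by rewrite /expandN; case: ifP => /= on; rewrite ?odd_double ?on. Qed.

End ExpandingUnitary.

Lemma leavitt_ind (R : comNzRingType) (E : digraph)
    (P : leavitt R E -> Prop) :
  (forall v, P (lvert R v)) -> (forall e, P (ledge R e)) ->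
  (forall e, P (lghost R e)) -> (forall x y, P x -> P y -> P (x + y)) ->
  (forall k x, P x -> P (k *: x)) -> (forall x y, P x -> P y -> P (x ** y)) ->
  P 0 -> forall x, P x.
Proof.
move=> Pv Pe Pg PD PZ PM P0 x; have [t ->] := lpi_surj x.
elim: t => [||||s Ps t Pt|s Ps|k s Ps|s Ps t Pt] //.
- by rewrite lpiD; apply: PD.
- by rewrite lpiN -scaleN1r; apply: PZ.
- by rewrite lpiZ; apply: PZ.
- by rewrite lpiM; apply: PM.
Qed.

(** * Paths and ghost paths *)

Section LeavittPaths.
Variables (R : comNzRingType) (E : digraph).
Implicit Types (x y : leavitt R E) (u v : vertex E) (e f : edge E).
Implicit Types (p q : seq (edge E)).

Let G := leavitt_generators R E.

Lemma vertMvert u v : lvert R u ** lvert R v = if u == v then lvert R u else 0.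
Proof. by case: eqVneq => [<-|/(lf_orth G)]; rewrite ?(lf_idem G). Qed.

Lemma vertMedge v e :
  lvert R v ** ledge R e = if v == src e then ledge R e else 0.
Proof.
case: eqVneq => [->|ve]; first exact: (lf_src_edge G).
by rewrite -(lf_src_edge G) numulA (lf_orth G ve) nu0mul.
Qed.

Lemma ghostMvert e v :
  lghost R e ** lvert R v = if src e == v then lghost R e else 0.
Proof.
case: eqVneq => [<-|ve]; first exact: (lf_ghost_src G).
by rewrite -(lf_ghost_src G) -numulA (lf_orth G ve) numul0.
Qed.

Lemma leavitt_right_vertices x :
  exists L : seq (leavitt R E * vertex E), x = \sum_(i <- L) i.1 ** lvert R i.2.
Proof.
elim/leavitt_ind: x => [v|e|e|x y [L ->] [M ->]|k x [L ->]|x y _ [L ->]|].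
- by exists [:: (lvert R v, v)]; rewrite big_seq1 (lf_idem G).
- by exists [:: (ledge R e, rng e)]; rewrite big_seq1 (lf_edge_rng G).
- by exists [:: (lghost R e, src e)]; rewrite big_seq1 (lf_ghost_src G).
- by exists (L ++ M); rewrite big_cat.
- exists [seq (k *: i.1, i.2) | i <- L]; rewrite big_map scaler_sumr.
  by apply: eq_bigr => i _; rewrite nuscalerAl.
- exists [seq (x ** i.1, i.2) | i <- L]; rewrite big_map numul_sumr.
  by apply: eq_bigr => i _; rewrite numulA.
- by exists [::]; rewrite big_nil.
Qed.

(** The vertices replace a unit, which is missing when there are infinitely many of them: [x] is a
    finite sum of terms ending in vertices, and the terms ending in [v] add up to
    [x ** lvert R v]. *)
Lemma leavitt_vert_eq0 x : (forall v, x ** lvert R v = 0) -> x = 0.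
Proof.
have [L xL] := leavitt_right_vertices x => x0.
rewrite xL (partition_big_map snd) big1 // => v _; rewrite -[RHS](x0 v) xL.
rewrite numul_suml [LHS]big_mkcond; apply: eq_bigr => i _.
by rewrite -numulA vertMvert; case: eqVneq => [->|_]; rewrite ?numul0.
Qed.

(** A path is a list of edges together with its final vertex [v], which is also the source of the
    empty path. *)
Definition path_src v p := if p is e :: _ then src e else v.

Fixpoint path_to v p :=
  if p is e :: q then (rng e == path_src v q) && path_to v q else true.

(* Zero unless [p] is a path ending at [v]. *)
Definition lpath v p : leavitt R E :=
  foldr (fun e x => ledge R e ** x) (lvert R v) p.

Lemma vertMpath u v p : lvert R u ** lpath v p =
  if u == path_src v p then lpath v p else 0.
Proof.
case: p => [|e p] /=.
  by rewrite vertMvert; case: eqP => // ->.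
by rewrite numulA vertMedge; case: ifP; rewrite ?nu0mul.
Qed.

Lemma lpath_eq0 v p : ~~ path_to v p -> lpath v p = 0.
Proof.
elim: p => //= e p IH; rewrite negb_and => /orP[/negPf ep|/IH->].
  by rewrite -(lf_edge_rng G) -numulA vertMpath ep numul0.
by rewrite numul0.
Qed.

Lemma lpathMvert v p u :
  lpath v p ** lvert R u = if v == u then lpath v p else 0.
Proof.
elim: p => [|e p IH] /=; first exact: vertMvert.
by rewrite -numulA IH; case: ifP; rewrite ?numul0.
Qed.

Lemma lpathMedge v p e :
  lpath v p ** ledge R e = if v == src e then lpath (rng e) (rcons p e) else 0.
Proof.
elim: p => [|f p IH] /=; first by rewrite vertMedge (lf_edge_rng G).
by rewrite -numulA IH; case: ifP; rewrite ?numul0.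
Qed.

Definition real_span x := exists L : seq (R * (vertex E * seq (edge E))),
  x = \sum_(i <- L) i.1 *: lpath i.2.1 i.2.2.

Lemma real_span0 : real_span 0.
Proof. by exists [::]; rewrite big_nil. Qed.

Lemma real_spanD x y : real_span x -> real_span y -> real_span (x + y).
Proof. by move=> [L ->] [M ->]; exists (L ++ M); rewrite big_cat. Qed.

Lemma real_spanZ k x : real_span x -> real_span (k *: x).
Proof.
move=> [L ->]; exists [seq (k * i.1, i.2) | i <- L].
by rewrite big_map scaler_sumr; apply: eq_bigr => i _; rewrite scalerA.
Qed.

Lemma real_span_sum (I : Type) (s : seq I) (F : I -> leavitt R E) :
  (forall i, real_span (F i)) -> real_span (\sum_(i <- s) F i).
Proof.
by move=> FR; apply: big_ind => //; [exact: real_span0|exact: real_spanD].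
Qed.

Lemma real_span_path v p : real_span (lpath v p).
Proof. by exists [:: (1, (v, p))]; rewrite big_seq1 scale1r. Qed.

Lemma real_spanMvert x v : real_span x -> real_span (x ** lvert R v).
Proof.
move=> [L ->]; rewrite numul_suml; apply: real_span_sum => i.
rewrite -nuscalerAl; apply: real_spanZ; rewrite lpathMvert.
by case: ifP => _; [exact: real_span_path|exact: real_span0].
Qed.

Lemma real_spanMedge x e : real_span x -> real_span (x ** ledge R e).
Proof.
move=> [L ->]; rewrite numul_suml; apply: real_span_sum => i.
rewrite -nuscalerAl; apply: real_spanZ; rewrite lpathMedge.
by case: ifP => _; [exact: real_span_path|exact: real_span0].
Qed.

(* The span of the products of a path and of at most [n] ghost edges. *)
Fixpoint ghost_span n x : Prop :=
  if n is m.+1 then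
    exists z (s : seq (edge E)) (y : edge E -> leavitt R E),
      [/\ real_span z, uniq s, forall e, ghost_span m (y e) &
          x = z + \sum_(e <- s) y e ** lghost R e]
  else real_span x.

Lemma real_ghost_span n x : real_span x -> ghost_span n x.
Proof.
case: n => //= n Rx; exists x, [::], (fun=> 0); rewrite big_nil addr0.
split=> // _; elim: n => [|n IH]; first exact: real_span0.
exists 0, [::], (fun=> 0); rewrite big_nil addr0.
by split=> //; exact: real_span0.
Qed.

Lemma ghost_span0 n : ghost_span n 0.
Proof. by apply: real_ghost_span; exact: real_span0. Qed.

Lemma ghost_spanS n x : ghost_span n x -> ghost_span n.+1 x.
Proof.
elim: n x => [|n IH] x; first exact: (@real_ghost_span 1).
move=> [z [s [y [Rz us yn ->]]]]; exists z, s, y.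
by split=> // e; exact: IH (yn e).
Qed.

Lemma ghost_span_leq m n x : (m <= n)%N -> ghost_span m x -> ghost_span n x.
Proof.
by move=> /subnKC<-; elim: (n - m)%N => [|k IH] mx; rewrite ?addn0 // addnS;
  apply: ghost_spanS; apply: IH.
Qed.

Lemma ghost_spanD n x y :
  ghost_span n x -> ghost_span n y -> ghost_span n (x + y).
Proof.
elim: n x y => [|n IH] x y; first exact: real_spanD.
move=> [z [s [a [Rz us an ->]]]] [z' [s' [a' [Rz' us' an' ->]]]].
pose r := undup (s ++ s').
(* Both sums are brought to one list of ghost edges, with coefficient 0 outside their own lists. *)
have extend (t : seq (edge E)) (b : edge E -> leavitt R E) :
    uniq t -> {subset t <= r} ->
    \sum_(e <- t) b e ** lghost R e =
    \sum_(e <- r) (if e \in t then b e else 0) ** lghost R e.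
  move=> ut tr; under [RHS]eq_bigr do rewrite (fun_if (fun w => w ** _)) nu0mul.
  rewrite -big_mkcond -big_filter; apply: perm_big; apply: uniq_perm => //.
    by rewrite filter_uniq // undup_uniq.
  move=> e; rewrite mem_filter; case et: (e \in t) => //=.
  by apply/esym; apply: tr.
exists (z + z'), r, (fun e => (if e \in s then a e else 0) +
                              (if e \in s' then a' e else 0)); split.
- exact: real_spanD.
- exact: undup_uniq.
- move=> e; apply: IH; case: ifP => _; do ?exact: ghost_span0.
    exact: an.
  exact: an'.
- rewrite addrACA; congr (_ + _).
  rewrite (extend s) // => [|e es]; last by rewrite mem_undup mem_cat es.
  rewrite (extend s') // => [|e es]; last by rewrite mem_undup mem_cat es orbT.
  by rewrite -big_split /=; under [RHS]eq_bigr do rewrite numulDl.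
Qed.

Lemma ghost_spanZ n k x : ghost_span n x -> ghost_span n (k *: x).
Proof.
elim: n x => [|n IH] x; first exact: real_spanZ.
move=> [z [s [y [Rz us yn ->]]]]; exists (k *: z), s, (fun e => k *: y e).
split=> //; [exact: real_spanZ|by move=> e; exact: IH (yn e)|].
rewrite scalerDr scaler_sumr; congr (_ + _).
by apply: eq_bigr => e _; rewrite nuscalerAl.
Qed.

Lemma ghost_spanMvert n x v : ghost_span n x -> ghost_span n (x ** lvert R v).
Proof.
elim: n x => [|n IH] x; first exact: real_spanMvert.
move=> [z [s [y [Rz us yn ->]]]].
exists (z ** lvert R v), s, (fun e => if src e == v then y e else 0).
split=> //; first exact: real_spanMvert.
  by move=> e; case: ifP => _; [exact: yn|exact: ghost_span0].
rewrite numulDl numul_suml; congr (_ + _); apply: eq_bigr => e _.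
by rewrite -numulA ghostMvert; case: ifP; rewrite ?numul0 ?nu0mul.
Qed.

(** Only the term of [e] survives, by [e^* f = 0] for f other than [e], and it loses its ghost edge.
    This lowers the ghost degree in the induction that proves injectivity. *)
Lemma ghost_sumMedge z (s : seq (edge E)) (y : edge E -> leavitt R E) e :
  uniq s -> (z + \sum_(f <- s) y f ** lghost R f) ** ledge R e =
  z ** ledge R e + if e \in s then y e ** lvert R (rng e) else 0.
Proof.
move=> us; rewrite numulDl numul_suml; congr (_ + _).
under eq_bigr do rewrite -numulA (lf_ghost_edge G).
case: ifP => es; last first.
  rewrite big_seq big1 // => f fs; case: eqP => [fe|_]; last exact: numul0.
  by rewrite -fe fs in es.
rewrite (bigD1_seq e) //= eqxx big1 ?addr0 // => f /negPf ->.
exact: numul0.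
Qed.

Lemma ghost_spanMedge n x e :
  ghost_span n.+1 x -> ghost_span n (x ** ledge R e).
Proof.
move=> [z [s [y [Rz us yn ->]]]]; rewrite ghost_sumMedge //.
apply: ghost_spanD; first exact/real_ghost_span/real_spanMedge.
case: ifP => _; [exact: ghost_spanMvert (yn e)|exact: ghost_span0].
Qed.

(** Right multiplication by a generator preserves having a finite degree, a ghost edge raising the
    bound by one; hence so does right multiplication by any element. Each generator is a vertex,
    that is an empty path, times itself. *)
Lemma exists_ghost_span x : exists n, ghost_span n x.
Proof.
have spanMr w : (exists n, ghost_span n w) ->
    forall y, exists n, ghost_span n (w ** y).
  move=> wn y; elim/leavitt_ind: y w wn
    => [v|e|e|y z IHy IHz|k y IHy|y z IHy IHz|] w wn.
  - by have [n nw] := wn; exists n; apply: ghost_spanMvert.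
  - have [n nw] := wn; exists n; apply: ghost_spanMedge; exact: ghost_spanS.
  - have [n nw] := wn; exists n.+1, 0, [:: e], (fun=> w).
    by rewrite big_seq1 add0r; split=> //; exact: real_span0.
  - have [m mw] := IHy _ wn; have [n nw] := IHz _ wn.
    exists (maxn m n); rewrite numulDr; apply: ghost_spanD.
      exact: ghost_span_leq (leq_maxl _ _) mw.
    exact: ghost_span_leq (leq_maxr _ _) nw.
  - have [n nw] := IHy _ wn; exists n.
    by rewrite -nuscalerAr; apply: ghost_spanZ.
  - by rewrite numulA; apply: IHz; apply: IHy.
  - by exists 0%N; rewrite numul0; exact: real_span0.
have vspan v y : exists n, ghost_span n (lvert R v ** y).
  by apply: spanMr; exists 0%N; apply: (real_span_path v [::]).
elim/leavitt_ind: x => [v|e|e|x y [m mx] [n ny]|k x [n nx]|x y xn _|].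
- by have := vspan v (lvert R v); rewrite (lf_idem G).
- by have := vspan (src e) (ledge R e); rewrite (lf_src_edge G).
- by have := vspan (rng e) (lghost R e); rewrite (lf_rng_ghost G).
- exists (maxn m n); apply: ghost_spanD.
    exact: ghost_span_leq (leq_maxl _ _) mx.
  exact: ghost_span_leq (leq_maxr _ _) ny.
- by exists n; apply: ghost_spanZ.
- exact: spanMr.
- by exists 0%N; exact: real_span0.
Qed.

End LeavittPaths.

(** * Embedding countable graphs *)

Lemma isometry_act_inj (R : comNzRingType) (x : L2 R) (m n : nat) phi :
  star x ** x = lone R rose2 -> natact x (delta R m) = phi ->
  natact x (delta R n) = phi -> m = n.
Proof.
move=> xx xm xn; apply: (@delta_inj R).
by rewrite -[delta R m]natact_lone -xx natactM xm -xn -natactM xx natact_lone.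
Qed.

(** Applying [star x] to the common image would give both [delta R m] and 0. *)
Lemma orthogonal_act_disjoint (R : comNzRingType) (x y : L2 R) (m n : nat) phi :
  star x ** x = lone R rose2 -> star x ** y = 0 ->
  natact x (delta R m) = phi -> natact y (delta R n) = phi -> False.
Proof.
move=> xx xy xm yn; have := oner_eq0 R; suff -> : 1 = 0 :> R by rewrite eqxx.
transitivity (delta R m m); first by rewrite /delta eqxx.
by rewrite -[delta R m]natact_lone -xx natactM xm -yn -natactM xy natact0.
Qed.

Section Embedding.
Variables (R : comNzRingType) (E : digraph).
Variables (wv : vertex E -> seq bool) (we : edge E -> seq bool).
Hypothesis wv_orth : forall v w, v != w ->
  star (wordL2 R (wv v)) ** wordL2 R (wv w) = 0.
Hypothesis we_orth : forall e f, src e = src f -> e != f ->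
  star (wordL2 R (we e)) ** wordL2 R (we f) = 0.
Hypothesis we_complete : forall v s, uniq s -> s != [::] ->
  (forall f, (f \in s) = (src f == v)) ->
  \sum_(f <- s) word_proj R (we f) = lone R rose2.
Hypothesis we_expanding : forall e n, (0 < n)%N -> ~~ odd n ->
  expanding (wordN (we e) n).
Implicit Types (x y : leavitt R E) (u v : vertex E) (e f : edge E).
Implicit Types (p q : seq (edge E)) (m n : nat).

Definition edge_iso e : L2 R := wordL2 R (we e) ** expand R.

Definition edge_image e : L2 R :=
  wordL2 R (wv (src e)) ** (edge_iso e ** star (wordL2 R (wv (rng e)))).

Lemma word_cancel w (z : L2 R) : star (wordL2 R w) ** (wordL2 R w ** z) = z.
Proof. by rewrite numulA wordL2K mul1L2. Qed.

Lemma edge_isoK e : star (edge_iso e) ** edge_iso e = lone R rose2.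
Proof. by rewrite starM -numulA word_cancel expandK. Qed.

Lemma edge_iso_orth e f : src e = src f -> e != f ->
  star (edge_iso e) ** edge_iso f = 0.
Proof.
move=> sef ef.
by rewrite starM -numulA [X in _ ** X]numulA we_orth // nu0mul numul0.
Qed.

Lemma star_edge_image e : star (edge_image e) =
  wordL2 R (wv (rng e)) ** (star (edge_iso e) ** star (wordL2 R (wv (src e)))).
Proof. by rewrite starM [star (edge_iso e ** _)]starM starK -numulA. Qed.

Lemma embed_family : leavitt_family (fun v => word_proj R (wv v))
  edge_image (fun e => star (edge_image e)).
Proof.
split=> [v|v w vw|e|e|e|e|e f|v s us s0 sE]; rewrite ?star_edge_image.
- by rewrite /word_proj -numulA word_cancel.
- by rewrite /word_proj -numulA [X in _ ** X]numulA wv_orth // nu0mul numul0.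
- by rewrite /word_proj -numulA word_cancel.
- by rewrite /word_proj /edge_image -!numulA word_cancel.
- by rewrite /word_proj -numulA word_cancel.
- by rewrite /word_proj -!numulA word_cancel.
- have [<-|ef] := eqVneq e f.
    rewrite /edge_image -2!numulA word_cancel.
    by rewrite [star (edge_iso e) ** _]numulA edge_isoK mul1L2.
  rewrite /edge_image -2!numulA [star (wordL2 R (wv (src e))) ** _]numulA.
  have [sef|sef] := eqVneq (src e) (src f).
    rewrite sef wordL2K mul1L2 [star (edge_iso e) ** _]numulA edge_iso_orth //.
    by rewrite nu0mul numul0.
  by rewrite wv_orth // nu0mul !numul0.
(* The unit inserted between [W_v] and [W_v^*] is expanded along the complete code of the edges
   leaving [v]; [U U^* = 1] then identifies the summands with those of the relation. *)
- rewrite /word_proj -[X in X ** _]mulL21 -(we_complete us s0 sE).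
  rewrite numul_sumr numul_suml big_seq [RHS]big_seq; apply: eq_bigr => f.
  rewrite sE => /eqP sf; rewrite star_edge_image /edge_image sf -!numulA.
  rewrite word_cancel /word_proj /edge_iso starM -!numulA.
  by rewrite [expand R ** _]numulA expandVK mul1L2.
Qed.

Definition embed x : L2 R := teval (fun v => word_proj R (wv v))
  edge_image (fun e => star (edge_image e)) (repr x).

Lemma embed_lpi t : embed (lpi t) = teval (fun v => word_proj R (wv v))
  edge_image (fun e => star (edge_image e)) t.
Proof. exact: teval_cong embed_family (repr_lpi t). Qed.

Lemma embedD x y : embed (x + y) = embed x + embed y.
Proof. by rewrite [x + y]/(lpi _) embed_lpi. Qed.

Lemma embedZ k x : embed (k *: x) = k *: embed x.
Proof. by rewrite [k *: x]/(lpi _) embed_lpi. Qed.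

Lemma embedM x y : embed (x ** y) = embed x ** embed y.
Proof. by rewrite [x ** y]/(lpi _) embed_lpi. Qed.

Lemma embed0 : embed 0 = 0.
Proof. by rewrite -lpi0 embed_lpi. Qed.

Lemma embed_sum (I : Type) (s : seq I) (F : I -> leavitt R E) :
  embed (\sum_(i <- s) F i) = \sum_(i <- s) embed (F i).
Proof. exact: (big_morph embed embedD embed0). Qed.

Lemma embed_star_hom : star_hom embed.
Proof.
split; [by move=> k x y; rewrite embedD embedZ|exact: embedM|].
elim/leavitt_ind => [v|e|e|x y IHx IHy|k x IHx|x y IHx IHy|].
- by rewrite lstar_vert embed_lpi /= starM starK.
- by rewrite lstar_edge !embed_lpi.
- by rewrite lstar_ghost !embed_lpi /= starK.
- by rewrite starD !embedD starD IHx IHy.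
- by rewrite starZ !embedZ starZ IHx.
- by rewrite starM !embedM starM IHx IHy.
- by rewrite star0 embed0 star0.
Qed.

(** * Movement of points along edges and paths *)

Definition point v n := wordN (wv v) n.
(** In the coordinates given by [point], this is how the edge [e] carries an expanding [n] from
    [rng e] to [src e]: first U, then the word of [e]. *)
Definition edge_step e n := wordN (we e) (expandN n).

Lemma expanding_edge_step e n : expanding n -> expanding (edge_step e n).
Proof.
move=> en; apply: we_expanding; last by rewrite odd_expandN.
exact: leq_ltn_trans (expandN_gt en).
Qed.

Lemma edge_step_gt e n : expanding n -> (n < edge_step e n)%N.
Proof. by move=> /expandN_gt/leq_trans; apply; exact: leq_wordN. Qed.

Lemma natact_edge_iso e n : expanding n ->
  natact (edge_iso e) (delta R n) = delta R (edge_step e n).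
Proof. by move=> en; rewrite natactM natact_expand // natact_word. Qed.

Lemma natact_star_word w n :
  natact (star (wordL2 R w)) (delta R (wordN w n)) = delta R n.
Proof. by rewrite -natact_word -natactM wordL2K natact_lone. Qed.

Lemma natact_vert v n : natact (embed (lvert R v)) (delta R (point v n)) =
  delta R (point v n).
Proof. by rewrite embed_lpi /= natactM natact_star_word natact_word. Qed.

Lemma natact_edge e n : expanding n ->
  natact (embed (ledge R e)) (delta R (point (rng e) n)) =
  delta R (point (src e) (edge_step e n)).
Proof.
move=> en; rewrite embed_lpi /= /edge_image natactM.
rewrite [natact (edge_iso e ** _) _]natactM.
by rewrite natact_star_word natact_edge_iso // natact_word.
Qed.

Lemma point_inj u v m n : point u m = point v n -> u = v /\ m = n.
Proof.
move=> uv; have um := natact_word R (wv u) m; have vn := natact_word R (wv v) n.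
rewrite -[wordN (wv v) n]uv in vn.
have uv0 : u = v.
  apply/eqP/negPn/negP => neq_uv.
  exact: orthogonal_act_disjoint (wordL2K _ _) (wv_orth neq_uv) um vn.
rewrite -uv0 in vn *; split=> //.
by apply: isometry_act_inj um vn; exact: wordL2K.
Qed.

Lemma edge_step_inj e f m n : src e = src f -> expanding m -> expanding n ->
  edge_step e m = edge_step f n -> e = f /\ m = n.
Proof.
move=> sef em en emn; have um := natact_edge_iso e em.
have vn := natact_edge_iso f en; rewrite -emn in vn.
have ef0 : e = f.
  apply/eqP/negPn/negP => ef.
  exact: orthogonal_act_disjoint (edge_isoK _) (edge_iso_orth sef ef) um vn.
rewrite -ef0 in vn *; split=> //.
by apply: isometry_act_inj um vn; exact: edge_isoK.
Qed.

Definition path_step p n := foldr edge_step n p.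

Lemma expanding_path_step p n : expanding n -> expanding (path_step p n).
Proof. by move=> en; elim: p => //= e p; exact: expanding_edge_step. Qed.

Lemma leq_path_step p n : expanding n -> (n <= path_step p n)%N.
Proof.
move=> en; elim: p => //= e p IH; apply: leq_trans IH (ltnW _).
exact/edge_step_gt/expanding_path_step.
Qed.

Lemma natact_path v p n : path_to v p -> expanding n ->
  natact (embed (lpath R v p)) (delta R (point v n)) =
  delta R (point (path_src v p) (path_step p n)).
Proof.
move=> vp en; elim: p vp => [_|e p IH /= /andP[/eqP ep vp]] /=.
  exact: natact_vert.
by rewrite embedM natactM IH // -ep natact_edge //; apply: expanding_path_step.
Qed.

(* A closed path moves every point of the expanding set to a larger one. *)
Lemma path_step_inj v p q n : path_to v p -> path_to v q -> expanding n ->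
  point (path_src v p) (path_step p n) = point (path_src v q) (path_step q n) ->
  p = q.
Proof.
move=> vp vq en; have no_loop e r : n <> edge_step e (path_step r n).
  move=> nr; have := edge_step_gt e (expanding_path_step r en).
  by rewrite -nr ltnNge leq_path_step.
elim: p q vp vq => [|e p IH] [|f q] //=.
- by move=> _ _ /point_inj[_ /no_loop].
- by move=> _ _ /point_inj[_ /esym/no_loop].
move=> /andP[/eqP ep vp] /andP[/eqP fq vq] /point_inj[sef].
have [ep_n fq_n] := (expanding_path_step p en, expanding_path_step q en).
move=> /(edge_step_inj sef ep_n fq_n)[ef pq]; rewrite ef; congr (_ :: _).
by apply: IH => //; rewrite -ep -fq ef pq.
Qed.

Lemma natact_lincomb (I : Type) (s : seq I) (k : I -> R) (F : I -> L2 R) phi n :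
  natact (\sum_(i <- s) k i *: F i) phi n =
  \sum_(i <- s) k i * natact (F i) phi n.
Proof.
elim: s => [|i s IH]; first by rewrite !big_nil natact0.
by rewrite !big_cons natactD IH natactZ.
Qed.

(** One expanding point at [v] suffices. Distinct paths ending at [v] move it to distinct points, so
    the value at the image of the path [p] is the total coefficient of [p], over all its occurrences
    in the list. Lists that are not paths contribute 0. *)
Lemma real_span_faithful x v n : real_span x -> expanding n ->
  natact (embed x) (delta R (point v n)) = (fun=> 0) -> x ** lvert R v = 0.
Proof.
move=> [L xL] en x0.
pose M := [seq i <- L | (i.2.1 == v) && path_to v i.2.2].
have xM : x ** lvert R v = \sum_(i <- M) i.1 *: lpath R v i.2.2.
  rewrite xL numul_suml big_filter [RHS]big_mkcond; apply: eq_bigr => i _.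
  rewrite -nuscalerAl lpathMvert.
  case: eqP => [->|_] /=; last by rewrite scaler0.
  by case: ifPn => // /lpath_eq0 ->; rewrite scaler0.
rewrite xM (partition_big_map (fun i => i.2.2)) big_seq big1 // => p.
rewrite mem_undup => /mapP[i0]; rewrite mem_filter => /andP[/andP[_ vp] _] pE.
rewrite -pE in vp.
rewrite (eq_bigr (fun i => i.1 *: lpath R v p)); last by move=> i /eqP <-.
rewrite -scaler_suml; set c := (X in X *: _).
suff -> : c = 0 by rewrite scale0r.
pose z := point (path_src v p) (path_step p n).
have : natact (embed (x ** lvert R v)) (delta R (point v n)) z = 0.
  by rewrite embedM natactM natact_vert x0.
rewrite xM embed_sum; under eq_bigr do rewrite embedZ.
rewrite natact_lincomb => <-; rewrite /c big_mkcond big_seq [RHS]big_seq.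
apply: eq_bigr => i; rewrite mem_filter => /andP[/andP[_ vi] _].
rewrite natact_path // /delta; have [ip|ip] := eqVneq i.2.2 p.
  by rewrite ip eqxx mulr1.
case: eqP => [zi|_]; last by rewrite mulr0.
by case/eqP: ip; apply/esym; exact: path_step_inj en zi.
Qed.

(* Write [x = z + \sum_(e in s) y e ** e^*] with [z] real. By induction
   [x ** e = 0] for [e] in [s], so [x = z - \sum_(e in s) z ** e ** e^*]. At a
   vertex [v] whose edges all lie in [s] the last sum is [z ** v] by the
   Cuntz-Krieger relation (or [v] is a sink); otherwise an edge [e] from [v]
   outside [s] gives [x ** e = z ** e], which is real, and so [z ** v = 0]. *)
Lemma embed_eq0 x : embed x = 0 -> x = 0.
Proof.
have [N] := exists_ghost_span x; have en : expanding 1 by [].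
elim: N x => [|N IH] x /= Nx fx0.
  apply: leavitt_vert_eq0 => v; apply: (real_span_faithful Nx en).
  by rewrite fx0 natact0.
have [z [s [y [Rz us yN xE]]]] := Nx.
have xe0 e : e \in s -> x ** ledge R e = 0.
  move=> es; apply: IH; first exact: ghost_spanMedge.
  by rewrite embedM fx0 nu0mul.
have G := leavitt_generators R E.
have xz : x = z - \sum_(e <- s) z ** (ledge R e ** lghost R e).
  rewrite {1}xE; congr (_ + _); rewrite -sumrN big_seq [RHS]big_seq.
  apply: eq_bigr => e es; apply/eqP; rewrite -addr_eq0 numulA; apply/eqP.
  rewrite -[y e ** _](_ : y e ** lvert R (rng e) ** lghost R e = _).
    by rewrite -numulDl addrC; have := xe0 e es;
      rewrite xE ghost_sumMedge // es => ->; rewrite nu0mul.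
  by rewrite -numulA (lf_rng_ghost G).
apply: leavitt_vert_eq0 => v.
have xv : x ** lvert R v = z ** lvert R v -
    \sum_(e <- s | src e == v) z ** (ledge R e ** lghost R e).
  rewrite xz numulDl numulNl numul_suml; congr (_ - _).
  rewrite [RHS]big_mkcond; apply: eq_bigr => e _.
  by rewrite -!numulA ghostMvert; case: ifP; rewrite ?numul0.
have [[e /eqP ev es]|sv] := pselect (exists2 e, src e == v & e \notin s).
  have zv : z ** lvert R v = 0.
    apply: (real_span_faithful Rz (expanding_edge_step e en)).
    rewrite -ev -natact_edge // -natactM -embedM.
    have -> : z ** ledge R e = x ** ledge R e.
      by rewrite xE ghost_sumMedge // (negPf es) addr0.
    by rewrite embedM fx0 nu0mul natact0.
  rewrite xv zv sub0r big1 ?oppr0 // => f /eqP fv.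
  by rewrite -(lf_src_edge G) fv -!numulA numulA zv nu0mul.
pose r := [seq e <- s | src e == v].
have rE e : (e \in r) = (src e == v).
  rewrite mem_filter andb_idr // => ev.
  by apply/negPn/negP => es; apply: sv; exists e.
have [r0|r0] := eqVneq r [::].
  rewrite -big_filter -/r r0 big_nil subr0 in xv.
  rewrite xv; apply: (real_span_faithful Rz en).
  rewrite -[delta _ _]natact_vert -natactM -embedM -xv embedM fx0 nu0mul.
  exact: natact0.
rewrite xv -big_filter -/r -numul_sumr (lf_CK G _ r0 rE) ?filter_uniq //.
by rewrite subrr.
Qed.

Lemma embed_inj : injective embed.
Proof.
move=> x y xy; apply/eqP; rewrite -subr_eq0; apply/eqP/embed_eq0.
by rewrite -scaleN1r embedD embedZ xy scaleN1r subrr.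
Qed.

End Embedding.

Lemma countable_leavitt_embedding (R : comNzRingType) (E : digraph) :
  countable_graph E -> exists f : leavitt R E -> L2 R,
  [/\ star_hom f, injective f &
      finite_set [set: vertex E] -> [set: vertex E] !=set0 ->
      f (lone R E) = lone R rose2].
Proof.
move=> [cV cE]; have [wv [_ wv_orth wv_complete]] := exists_words R cV.
have ce v : countable [set e : edge E | src e = v].
  by apply: sub_countable cE; exact: subset_card_le.
have /choice[w wP] v := exists_words R (ce v).
(* The edges leaving each vertex have a prefix code of their own. *)
pose we e := w (src e) e.
have v_orth u v : u != v -> star (wordL2 R (wv u)) ** wordL2 R (wv v) = 0.
  exact: wv_orth.
have e_orth e f : src e = src f -> e != f ->
    star (wordL2 R (we e)) ** wordL2 R (we f) = 0.
  by move=> sef; rewrite /we sef; have [_ + _] := wP (src f); apply.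
have e_complete v s : uniq s -> s != [::] ->
    (forall f, (f \in s) = (src f == v)) ->
    \sum_(f <- s) word_proj R (we f) = lone R rose2.
  move=> us s0 sE.
  have [_ _ /(_ s us s0) <-] := wP v; last first.
    by move=> e; rewrite sE; split=> /eqP.
  rewrite big_seq [RHS]big_seq; apply: eq_bigr => e.
  by rewrite sE /we => /eqP ->.
have e_exp e n : (0 < n)%N -> ~~ odd n -> expanding (wordN (we e) n).
  by have [+ _ _] := wP (src e); apply.
exists (@embed R E wv we); split.
- exact: embed_star_hom.
- exact: embed_inj.
(* The image of the unit is the sum of the projections of a complete code. The vertex [v0] makes the
   list nonempty, as completeness demands; without vertices, [lone R E] is 0. *)
- move=> /finite_seqP[s0 s0E] [v0 _]; pose r := undup s0.
  have mem_r v : v \in r.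
    by have : [set: vertex E] v by []; rewrite s0E mem_undup.
  have -> : lone R E = \sum_(v <- r) lvert R v.
    rewrite fsbig_seq ?undup_uniq // /lone; congr (\sum_(v \in _) _).
    by apply/seteqP; split=> v //= _; exact: mem_r.
  rewrite embed_sum //; under eq_bigr do rewrite embed_lpi //=.
  apply: wv_complete; rewrite ?undup_uniq //.
  by apply/eqP => r0; have := mem_r v0; rewrite r0.
Qed.

(** * Uncountable graphs *)

(** A branching system with a point at [v] is built for an arbitrary graph. There [k *: lvert R v]
    sends the constant function 1 to one with value [k] at that point. *)
Lemma leavitt_vertZ_eq0 (R : comNzRingType) (E : digraph) (v : vertex E) k :
  k *: lvert R v = 0 -> k = 0.
Proof.
(* [out u] lists the edges leaving [u] if they are finitely many and at least one; it is empty at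
   sinks and infinite emitters. *)
have /choice[out outP] u : exists s : seq (edge E), [/\ uniq s,
    s != [::] -> forall f, (f \in s) = (src f == u) &
    forall r, uniq r -> r != [::] -> (forall f, (f \in r) = (src f == u)) ->
      s != [::]].
  have [[r [ur r0 rE]]|nr] := pselect (exists r : seq (edge E),
    [/\ uniq r, r != [::] & forall f, (f \in r) = (src f == u)]).
    by exists r; split.
  by exists [::]; split=> // r ur r0 rE; case: nr; exists r.
(* [N] absorbs finitely many copies of itself at a vertex emitting finitely
   many edges, and lists absorb the edges at an infinite emitter. *)
pose X := (vertex E * (nat * seq (edge E)))%type.
pose push e (x : X) : X := (src e,
  if out (src e) is e0 :: s then
    (x.2.1 * (size s).+1 + index e (e0 :: s), x.2.2)%N
  else (x.2.1, e :: x.2.2)).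
pose pull (x : X) : option (edge E * X) :=
  if out x.1 is e0 :: s then
    let e := nth e0 (e0 :: s) (x.2.1 %% (size s).+1) in
    Some (e, (rng e, (x.2.1 %/ (size s).+1, x.2.2)%N))
  else if x.2.2 is e :: l then
    if src e == x.1 then Some (e, (rng e, (x.2.1, l))) else None
  else None.
have loc_push e (x : X) : x.1 = rng e -> (push e x).1 = src e by [].
have pushK e (x : X) : x.1 = rng e -> pull (push e x) = Some (e, x).
  case: x => [u [m l]] /= ue; rewrite /pull /push [(_, _).1]/=.
  have [_ + _] := outP (src e); case: (out (src e)) => [|e0 s] sE.
    by rewrite /= eqxx -ue.
  have es : e \in e0 :: s by rewrite sE ?eqxx.
  have ei : (index e (e0 :: s) < (size s).+1)%N.
    by have := es; rewrite -index_mem.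
  rewrite [(_, _).2]/= [(_, _).1]/= [(_, _).2]/= modnMDl modn_small //.
  by rewrite nth_index // divnMDl // divn_small // addn0 -ue.
have pullK (x : X) e (y : X) :
    pull x = Some (e, y) -> push e y = x /\ y.1 = rng e.
  case: x => [u [m l]]; rewrite /pull /= /push.
  have [us + _] := outP u; case ou: (out u) us => [|e0 s] us sE.
    case: l => // f l; case: eqP => // fu [<- <-] /=.
    by rewrite fu ou.
  set f := nth _ _ _; move=> [<- <-].
  have ms : (m %% (size s).+1 < size (e0 :: s))%N by rewrite ltn_mod.
  have /eqP -> : src f == u by rewrite -sE // mem_nth.
  rewrite ou; split=> //; congr (_, (_, _)).
  rewrite -[LHS]/(m %/ (size s).+1 * (size s).+1 + index f (e0 :: s))%N.
  by rewrite (index_uniq e0 ms us) -divn_eq.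
have pull_regular (x : X) r : uniq r -> r != [::] ->
    (forall f, (f \in r) = (src f == x.1)) -> exists p, pull x = Some p.
  move=> ur r0 rE; have [_ _ /(_ r ur r0 rE)] := outP x.1.
  by rewrite /pull; case: (out x.1) => // e0 s _; eexists.
pose B := Branching loc_push pushK pullK pull_regular.
move=> kv0; have := leavitt_act0 B (fun=> 1 : R) (v, (0%N, [::])).
by rewrite -kv0 leavitt_actZ leavitt_act_lpi /= eqxx mulr1.
Qed.

(* Pad [A] with a zero column to a square [B]. If [A] had no left kernel, then
   neither would [B], so a monic polynomial annihilating [B] (Cayley-Hamilton)
   could be divided by ['X]: the last diagonal entry shows that its constant
   term vanishes. *)
Lemma left_kernel_neq0 (R : comNzRingType) (n : nat) (A : 'M[R]_(n.+1, n)) :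
  exists2 u : 'rV[R]_n.+1, u != 0 & u *m A = 0.
Proof.
apply: contrapT => noker; have kerA (u : 'rV_n.+1) : u *m A = 0 -> u = 0.
  by move=> uA; apply/eqP/negPn/negP => u0; apply: noker; exists u.
pose B : 'M[R]_n.+1 :=
  \matrix_(i, j) if unlift ord_max j is Some j' then A i j' else 0.
have mulB m (C : 'M_(m, n.+1)) i j :
    (C *m B) i (lift ord_max j) = (C *m A) i j.
  by rewrite !mxE; apply: eq_bigr => l _; rewrite mxE liftK.
have kerB (C : 'M_n.+1) : C *m B = 0 -> C = 0.
  move=> CB; apply/row_matrixP => i; rewrite row0; apply: kerA.
  apply/rowP => j; rewrite -row_mul [LHS]mxE -mulB CB.
  by rewrite !mxE.
have monic_neq0 (p : {poly R}) : p \is monic -> horner_mx B p <> 0.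
  elim/poly_ind: p => [|p c IH].
    by rewrite monicE lead_coef0 eq_sym oner_eq0.
  rewrite rmorphD rmorphM /= horner_mx_X horner_mx_C => pc_monic pB0.
  have c0 : c = 0.
    have := congr1 (fun M : 'M_n.+1 => M ord_max ord_max) pB0.
    rewrite !mxE eqxx mulr1n big1 ?add0r // => j _.
    by rewrite !mxE unlift_none mulr0.
  move: pB0 pc_monic; rewrite c0 raddf0 addr0 polyC0 addr0 monicE lead_coefMX.
  by move=> /kerB pB0 /IH.
exact: monic_neq0 (char_poly_monic B) (Cayley_Hamilton B).
Qed.

(** A left kernel vector of the coefficient matrix provides the relation. *)
Lemma lincomb_dependence (R : comNzRingType) (V : lmodType R) (n : nat)
    (b : 'I_n -> V) (y : 'I_n.+1 -> V) :
  (forall i, exists c : 'I_n -> R, y i = \sum_j c j *: b j) ->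
  exists u : 'I_n.+1 -> R, (exists i, u i != 0) /\ \sum_i u i *: y i = 0.
Proof.
move=> /choice[c yE]; have [u u0 uc] := left_kernel_neq0 (\matrix_(i, j) c i j).
exists (u ord0); split.
  apply: contrapT => nu; case/eqP: u0; apply/rowP => i; rewrite mxE.
  by apply/eqP/negPn/negP => ui; apply: nu; exists i.
under eq_bigr do rewrite yE scaler_sumr.
rewrite exchange_big big1 //= => j _; under eq_bigr do rewrite scalerA.
rewrite -scaler_suml; have /rowP/(_ j) := uc; rewrite !mxE.
by under eq_bigr do rewrite mxE; move=> ->; rewrite scale0r.
Qed.

(** * Monomials and independent families *)

Section CountableSpan.
Variable R : comNzRingType.

Definition monoL2 (w : seq (bool * bool)) : L2 R :=
  foldr (fun g x => (if g.1 then loop R g.2 else coloop R g.2) ** x)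
    (lone R rose2) w.

Lemma monoL2_cat u w : monoL2 (u ++ w) = monoL2 u ** monoL2 w.
Proof. by elim: u => [|b u IH] /=; rewrite ?mul1L2 // IH numulA. Qed.

Lemma monoL2_span (x : L2 R) :
  exists s : seq (R * seq (bool * bool)), x = \sum_(i <- s) i.1 *: monoL2 i.2.
Proof.
pose span x := exists s : seq (R * seq (bool * bool)),
  x = \sum_(i <- s) i.1 *: monoL2 i.2.
have span0 : span 0 by exists [::]; rewrite big_nil.
have spanD y z : span y -> span z -> span (y + z).
  by move=> [s ->] [t ->]; exists (s ++ t); rewrite big_cat.
have spanZ k y : span y -> span (k *: y).
  move=> [s ->]; exists [seq (k * i.1, i.2) | i <- s].
  by rewrite big_map scaler_sumr; apply: eq_bigr => i _; rewrite scalerA.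
have span_mono w : span (monoL2 w).
  by exists [:: (1, w)]; rewrite big_seq1 scale1r.
have span_sum (I : Type) (s : seq I) F :
    (forall i, span (F i)) -> span (\sum_(i <- s) F i).
  by move=> FS; apply: big_ind.
rewrite -/(span x); elim/leavitt_ind: x => [[]|b|b|||y z [s ->] [t ->]|] //.
- by rewrite -lone_rose2; apply: (span_mono [::]).
- by have := span_mono [:: (true, b)]; rewrite /= mulL21.
- by have := span_mono [:: (false, b)]; rewrite /= mulL21.
- rewrite numul_suml; apply: (span_sum) => i; rewrite -nuscalerAl numul_sumr.
  apply: (spanZ); apply: span_sum => j; rewrite -nuscalerAr -monoL2_cat.
  by apply: spanZ; exact: span_mono.
Qed.

(** The indices are sorted by the list [J] of monomials expressing [f (g t)]. There are countably
    many such lists, and each class is finite: more than [size J] members would be dependent after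
    [f], hence before it, as [f] is injective. *)
Lemma countable_independent (V : lmodType R) (f : {linear V -> L2 R})
    (T : choiceType) (g : T -> V) : injective f ->
  (forall n (t : 'I_n -> T) (u : 'I_n -> R), injective t ->
    \sum_i u i *: g (t i) = 0 -> forall i, u i = 0) ->
  countable [set: T].
Proof.
move=> f_inj indep; have /choice[s sE] t := monoL2_span (f (g t)).
pose word_list t := [seq i.2 | i <- s t].
have -> : [set: T] = \bigcup_(J in [set: seq (seq (bool * bool))])
    [set t | word_list t = J].
  by apply/seteqP; split=> t // _; exists (word_list t).
apply: bigcup_countable => // J _; apply: finite_set_countable.
apply: contrapT => /(infinite_set_fset (size J).+1)[D DJ sizeD].
have t0 : T by case: D DJ sizeD => [[|t D]].
pose t (i : 'I_(size J).+1) := nth t0 (finmap.enum_fset D) i.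
have i_size (i : 'I_(size J).+1) : (i < size (finmap.enum_fset D))%N.
  exact: leq_trans sizeD.
have t_inj : injective t.
  move=> i j /eqP; rewrite nth_uniq ?finmap.fset_uniq // => /eqP ij.
  exact: val_inj.
have tJ i : word_list (t i) = J by apply: DJ; exact: mem_nth.
have [|u [[i ui] uft]] := @lincomb_dependence _ _ _
    (fun j : 'I_(size J) => monoL2 (nth [::] J j)) (fun i => f (g (t i))).
  (* All members of the class share the list [J], so coefficients can be read off by position, even
     if [J] repeats a word. *)
  move=> i; exists (fun j => (nth (0, [::]) (s (t i)) j).1).
  rewrite sE (big_nth (0, [::])) big_mkord -(tJ i) /word_list size_map.
  by apply: eq_bigr => j _; rewrite (nth_map (0, [::])).
case/eqP: ui; apply: (indep _ t u t_inj); apply: f_inj.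
by rewrite linear0 -uft linear_sum; apply: eq_bigr => j _; rewrite linearZ.
Qed.

End CountableSpan.

(** Vertices and edges are each independent: a relation multiplied on the right by the i-th vertex,
    or on the left by the i-th ghost edge, reduces to the i-th coefficient times a vertex. *)
Lemma linear_embedding_countable (R : comNzRingType) (E : digraph)
    (f : {linear leavitt R E -> L2 R}) : injective f -> countable_graph E.
Proof.
move=> f_inj; have G := leavitt_generators R E.
split.
- apply: (countable_independent (g := @lvert R E) f_inj).
  move=> n t u t_inj ut0 i; apply: (@leavitt_vertZ_eq0 R E (t i)).
  rewrite -[RHS](nu0mul (lvert R (t i))) -ut0 numul_suml (bigD1 i) //=.
  rewrite -nuscalerAl (lf_idem G) big1 ?addr0 // => j ji.
  by rewrite -nuscalerAl (lf_orth G) ?scaler0 // (inj_eq t_inj).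
- apply: (countable_independent (g := @ledge R E) f_inj).
  move=> n t u t_inj ut0 i; apply: (@leavitt_vertZ_eq0 R E (rng (t i))).
  rewrite -[RHS](numul0 (lghost R (t i))) -ut0 numul_sumr (bigD1 i) //=.
  rewrite -nuscalerAr (lf_ghost_edge G) eqxx big1 ?addr0 // => j ji.
  rewrite -nuscalerAr (lf_ghost_edge G) (inj_eq t_inj) eq_sym (negPf ji).
  exact: scaler0.
Qed.

Theorem theorem4p1 (R : comNzRingType) (E : digraph) :
  [/\ countable_graph E ->
        exists f : leavitt R E -> L2 R, star_hom f /\ injective f,
      countable_graph E ->
        finite_set [set: vertex E] -> [set: vertex E] !=set0 ->
        exists f : leavitt R E -> L2 R,
          [/\ star_hom f, injective f & f (lone R E) = lone R rose2]
    & ~ countable_graph E ->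
        ~ exists f : {linear leavitt R E -> L2 R}, injective f].
Proof.
split=> [cE|cE fV V0|nE [f f_inj]].
- by have [f [f_hom f_inj _]] := countable_leavitt_embedding R cE; exists f.
- have [f [f_hom f_inj f1]] := countable_leavitt_embedding R cE.
  by exists f; split=> //; exact: f1.
- exact/nE/linear_embedding_countable/f_inj.
Qed.
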